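(* Let $P_1,P_2,P_3$ be independent random points in $\mathbb{R}^2$, each with a distribution invariant under rotation about the origin $O$, and let $R_k=\lVert P_k\rVert$, with $\Pr(R_k=0)=0$ for at least two of the three indices $k$. Then $$\Pr(\text{the triangle }P_1P_2P_3\text{ is obtuse})=\mathbb{E}\left[P_{\text{obt}}(R_1,R_2,R_3)\right].$$ Consequently, the set of obtuse probabilities achieved as $(P_1,P_2,P_3)$ ranges over all triples satisfying these hypotheses is exactly the interval $[1/2,1)$.
   Context: A triangle is obtuse if it is non-degenerate and has some interior angle exceeding $\pi/2$. For $r_1,r_2,r_3\ge0$ with at most one of them equal to zero, $P_{\text{obt}}(r_1,r_2,r_3)$ denotes the probability that the triangle $Q_1Q_2Q_3$ is obtuse, where $Q_1,Q_2,Q_3$ are independent and $Q_k$ is uniform on the circle of radius $r_k$ about $O$. Equivalently, $P_{\text{obt}}(r_1,r_2,r_3)=\frac12\sum_{k=1}^3\Pr(r_i^2\sin^2X+r_j^2\sin^2Y>r_k^2)$, where $X,Y$ are independent and uniform on $(0,\pi/2)$ and, in each summand, $\{i,j,k\}=\{1,2,3\}$. *)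

(* Defs.v *)
From HB Require Import structures.
From mathcomp Require Import all_boot all_order all_algebra.
From mathcomp Require Import all_classical all_reals all_analysis.
From mathcomp Require Import measurable_realfun.

Set Implicit Arguments.
Unset Strict Implicit.
Unset Printing Implicit Defensive.

Import Order.TTheory GRing.Theory Num.Theory.
Import numFieldNormedType.Exports.

Local Open Scope classical_set_scope.
Local Open Scope ring_scope.

Section plane.
Context {R : realType}.
Implicit Types (p q A B C : R * R) (r t : R).

Definition dot p q : R := p.1 * q.1 + p.2 * q.2.

(* The library norm `|p| on R * R is the sup norm, hence this definition. *)
Definition enorm p : R := Num.sqrt (dot p p).

Definition rotation t p : R * R :=
  (cos t * p.1 - sin t * p.2, sin t * p.1 + cos t * p.2).

(* Interior angle at A of the triangle ABC; meaningful when B and C differ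
   from A, in particular for all three vertices of a nondegenerate triangle. *)
Definition interior_angle A B C : R :=
  acos (dot (B - A) (C - A) / (enorm (B - A) * enorm (C - A))).

Definition nondegenerate A B C : Prop :=
  (B.1 - A.1) * (C.2 - A.2) - (B.2 - A.2) * (C.1 - A.1) != 0.

Definition obtuse A B C : Prop :=
  nondegenerate A B C /\
  [\/ pi / 2 < interior_angle A B C,
      pi / 2 < interior_angle B C A |
      pi / 2 < interior_angle C A B].

(* measurableTypeR R is R with the measurable structure under which the library
   states lebesgue_measure and uniform_prob. *)
Definition circle_point r : measurableTypeR R -> R * R :=
  fun t => (r * cos t, r * sin t).

Lemma measurable_circle_point r : measurable_fun setT (circle_point r).
Proof.
apply: measurable_fun_pair => /=; apply: measurable_funM => //.
- by apply: continuous_measurable_fun; exact: continuous_cos.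
- by apply: continuous_measurable_fun; exact: continuous_sin.
Qed.

HB.instance Definition _ r :=
  isMeasurableFun.Build _ _ _ _ (circle_point r) (measurable_circle_point r).

Lemma two_pi_gt0 : (0 : R) < 2 * pi.
Proof. by rewrite mulr_gt0 ?pi_gt0. Qed.

Definition uniform_circle r : probability (R * R)%type R :=
  distribution (uniform_prob two_pi_gt0) (circle_point r).

(* Meant for nonnegative radii at most one of which is zero; it is 0 when two
   radii vanish, since the triangle is then degenerate. *)
Definition P_obt r1 r2 r3 : R :=
  fine ((uniform_circle r1 \x uniform_circle r2 \x uniform_circle r3)%E
          [set q : (R * R) * (R * R) * (R * R) | obtuse q.1.1 q.1.2 q.2]).

End plane.

Section random_triangle.
Context d (T : measurableType d) (R : realType) (P : probability T R).

Definition independent_RVs d' (E : measurableType d') (I : finType)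
    (X : I -> {RV P >-> E}) : Prop :=
  forall (J : {set I}) (A : I -> set E), (forall i, measurable (A i)) ->
    P (\bigcap_(i in [set` J]) (X i @^-1` A i)) =
    (\prod_(i in J) P (X i @^-1` A i))%E.

Definition rotation_invariant (X : {RV P >-> (R * R)%type}) : Prop :=
  forall (t : R) (A : set (R * R)), measurable A ->
    distribution P X (rotation t @^-1` A) = distribution P X A.

Definition random_triangle (X : 'I_3 -> {RV P >-> (R * R)%type}) : Prop :=
  [/\ independent_RVs X,
      forall k, rotation_invariant (X k) &
      exists i j : 'I_3, [/\ i != j,
        P [set w | enorm (X i w) = 0] = 0%E &
        P [set w | enorm (X j w) = 0] = 0%E]].

Definition obtuse_event (X : 'I_3 -> {RV P >-> (R * R)%type}) : set T :=
  [set w | obtuse (X 0 w) (X 1 w) (X 2 w)].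

End random_triangle.

Definition achieved_obtuse_probabilities (R : realType) : set R :=
  [set p | exists (d : measure_display) (T : measurableType d)
             (P : probability T R) (X : 'I_3 -> {RV P >-> (R * R)%type}),
     random_triangle X /\ P (obtuse_event X) = p%:E].

(* Main.v *)
Require Import Defs.
From HB Require Import structures.
From mathcomp Require Import all_boot all_order all_algebra.
From mathcomp Require Import all_classical all_reals all_analysis.
From mathcomp Require Import measurable_realfun.
From mathcomp Require Import ring lra.

Import Order.TTheory GRing.Theory Num.Theory.
Import numFieldNormedType.Exports.
(* Restores [nondegenerate] for triangles, hidden by the one for forms. *)
Import Defs.

Local Open Scope classical_set_scope.
Local Open Scope ring_scope.

Set Implicit Arguments.
Unset Strict Implicit.
Unset Printing Implicit Defensive.

(** Rotation-invariant vertices keep their joint law when they are rotated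
    independently. Averaging over three independent uniform rotations replaces
    each vertex by a uniform point on its circle, and Fubini turns the
    probability into the expectation of [P_obt] at the three distances from the
    origin ([vertices_spin], [uniform_angles_spin], [obtuse_average]).

    The range then follows from [1/2 <= P_obt < 1] for nonnegative radii of
    which at most one vanishes, and from one explicit family of triangles.

    Lower bound ([half_le_obtuse]). By symmetry let [s <= m <= l] be the radii,
    with vertices [p], [q], [r]. Put [v = q - p], write [p x q] for
    [p.1 * q.2 - p.2 * q.1], and let [h = |p x q| / |v|] be the distance from
    the origin to the line [p q]. The angle at [p] or [q] is obtuse exactly
    when the projection of [r] on [v] lies outside of the projection of the
    segment [p q]. Since [q . v >= 0], symmetry of the circle shows that the
    conditional probability of this, given [p] and [q], is at least half of
    Pr(|r.1| > |p . v| / |v|) + Pr(|r.2| > q . v / |v|).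
    The main point is that [|p . v| / |v|] is stochastically at most [h]
    ([uniform_height_projection]): [v] is a uniform point of a circle whose
    disc contains the origin, so that, by the intersecting chords theorem, the
    directions of the line [p q] and of its perpendicular have the same law.
    In coordinates, [h > z] with [z = s * sin a = m * sin b] reads
    [cos (pi - a - b) < cos t < cos (a - b)], where [t] is the angle between
    [p] and [q], which has probability [1 - 2 * a / pi]. Replacing
    [|p . v| / |v|] by [h] inside the integral, the sum of the two
    probabilities is at least [1], because [h ^+ 2 + (q . v / |v|) ^+ 2 =
    m ^+ 2 <= l ^+ 2] ([uniform_circle_height_cover]).

    Upper bound ([obtuse_lt1_aux]). With positive probability the two outer
    vertices make an angle slightly smaller than a right one, and the third
    lies nearly orthogonally to their difference and on the side opposite to
    their sum, in which case no angle is obtuse ([not_obtuse]).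

    Every value is reached ([prob_obtuse_center]): with radii [0], [1] and
    [0 < c <= 1] the probability is [1 / 2 + acos c / pi]. *)

(** * Obtuse triangles in terms of dot products *)

Section geometry.
Context {R : realType}.
Implicit Types (p q A B C : R * R) (r t x : R).

Lemma pihalf_lt_acos x : -1 <= x <= 1 -> (pi / 2 < acos x) = (x < 0).
Proof.
move=> x1; rewrite -[in RHS](@acosK _ x) ?in_itv//= -(@cos_pihalf R).
have pi0 := @pi_gt0 R.
by rewrite ltr_cos// in_itv/= ?acos_ge0 ?acos_lepi//; apply/andP; split; lra.
Qed.

Lemma enorm_ge0 p : 0 <= enorm p.
Proof. exact: sqrtr_ge0. Qed.

Lemma dotpp_ge0 p : 0 <= dot p p.
Proof. by rewrite /dot -!expr2 addr_ge0// sqr_ge0. Qed.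

Lemma enorm_sqr p : enorm p ^+ 2 = dot p p.
Proof. by rewrite sqr_sqrtr// dotpp_ge0. Qed.

Lemma enorm_eq0 p : enorm p = 0 -> p = 0.
Proof.
move=> /(congr1 (fun x => x ^+ 2)); rewrite enorm_sqr expr0n/= /dot -!expr2.
move=> /eqP; rewrite paddr_eq0 ?sqr_ge0// !sqrf_eq0 => /andP[/eqP p1 /eqP p2].
by case: p p1 p2 => a b /= -> ->.
Qed.

Lemma enorm_gt0 p : p != 0 -> 0 < enorm p.
Proof.
move=> p0; rewrite lt_neqAle enorm_ge0 andbT eq_sym.
by apply: contra_neq p0; exact: enorm_eq0.
Qed.

Lemma cauchy_schwarz p q : `|dot p q| <= enorm p * enorm q.
Proof.
rewrite -(@ler_pXn2r _ 2)// ?nnegrE ?mulr_ge0 ?enorm_ge0//.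
rewrite exprMn !enorm_sqr real_normK ?num_real// /dot.
have := sqr_ge0 (p.1 * q.2 - p.2 * q.1); nra.
Qed.

Lemma pihalf_lt_angle A B C : B != A -> C != A ->
  (pi / 2 < interior_angle A B C) = (dot (B - A) (C - A) < 0).
Proof.
move=> BA CA; rewrite /interior_angle.
have dgt0 : 0 < enorm (B - A) * enorm (C - A).
  by rewrite mulr_gt0// enorm_gt0// subr_eq0.
rewrite pihalf_lt_acos; last first.
  by rewrite -ler_norml normrM normfV (gtr0_norm dgt0) ler_pdivrMr// mul1r
             cauchy_schwarz.
by rewrite pmulr_llt0// invr_gt0.
Qed.

Lemma nondegenerateC A B C : nondegenerate A B C -> nondegenerate B A C.
Proof. by rewrite /nondegenerate; apply: contra_neq; lra. Qed.

Lemma nondegenerateCA A B C : nondegenerate A B C -> nondegenerate B C A.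
Proof. by rewrite /nondegenerate; apply: contra_neq; lra. Qed.

Lemma nondegenerate_neq A B C : nondegenerate A B C -> B != A.
Proof.
rewrite /nondegenerate; apply: contra_neq => ->; rewrite !subrr; ring.
Qed.

(** A nondegenerate triangle is obtuse when two of its sides, seen as vectors
    from a common vertex, have a negative dot product. *)
Lemma obtuseP A B C : obtuse A B C <-> nondegenerate A B C /\
  [\/ dot (B - A) (C - A) < 0, dot (C - B) (A - B) < 0 |
      dot (A - C) (B - C) < 0].
Proof.
have H : nondegenerate A B C ->
    [/\ B != A, C != B & A != C].
  move=> n1; have n2 := nondegenerateCA n1; have n3 := nondegenerateCA n2.
  by split; apply: nondegenerate_neq; eassumption.
split=> -[n]; have [BA CB AC] := H n; split=> //; move: b.
  by rewrite !pihalf_lt_angle// 1?eq_sym.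
by rewrite !pihalf_lt_angle// 1?eq_sym.
Qed.

Lemma dotC p q : dot p q = dot q p.
Proof. by rewrite /dot; ring. Qed.

Lemma obtuse_swap12 A B C : obtuse A B C -> obtuse B A C.
Proof.
move=> /obtuseP[n o]; apply/obtuseP; split; first exact: nondegenerateC.
by case: o => o; [apply: Or32|apply: Or31|apply: Or33]; rewrite dotC.
Qed.

Lemma obtuse_swap23 A B C : obtuse A B C -> obtuse A C B.
Proof.
move=> /obtuseP[n o]; apply/obtuseP; split.
  by apply: nondegenerateCA; exact: nondegenerateC.
by case: o => o; [apply: Or31|apply: Or33|apply: Or32]; rewrite dotC.
Qed.

End geometry.
(** * The uniform law on an interval of angles *)

Section uniform_angle.
Context {R : realType}.
Local Notation mu := (@lebesgue_measure R).
Local Notation U := (uniform_prob (@two_pi_gt0 R)).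
Implicit Types (A : set (measurableTypeR R)) (s t a b : R).

(** Translation by [s], named so as to carry its measurability. *)
Definition translation s : measurableTypeR R -> measurableTypeR R :=
  fun t => t + s.

Lemma measurable_translation s : measurable_fun setT (translation s).
Proof. exact: measurable_funD. Qed.

HB.instance Definition _ s :=
  isMeasurableFun.Build _ _ _ _ (translation s) (measurable_translation s).

Lemma lebesgue_measure_shift s A : measurable A ->
  mu [set t | A (t + s)] = mu A.
Proof.
move=> mA.
have -> : mu [set t | A (t + s)] = pushforward mu (translation s) A by [].
apply/esym/lebesgue_measure_unique => //= _ [[a b]] _ <-.
rewrite /pushforward.
have -> : translation s @^-1` `]a, b]%classic = `]a - s, b - s]%classic.
  by apply/seteqP; split=> t /=; rewrite !in_itv/= ltrBlDr lerBrDr.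
rewrite !lebesgue_measure_itv/= !lte_fin ltrD2r.
by case: ifPn => // _; rewrite -!EFinB; congr EFin; ring.
Qed.

Lemma uniform_angleE A : measurable A ->
  U A = (((2 * pi)^-1)%R%:E * mu (A `&` `[0, 2 * pi]%classic)%R)%E.
Proof.
move=> mA; rewrite /uniform_prob integral_uniform_pdf.
pose k : R := (2 * pi)^-1; rewrite (eq_integral (fun=> k%:E)); last first.
  by move=> x; rewrite inE/= => -[_]; rewrite in_itv/= /uniform_pdf => ->;
    rewrite subr0.
by rewrite integral_cst//; exact: measurableI.
Qed.

Lemma uniform_angle_itv (bl br : bool) a b : 0 <= a -> a <= b -> b <= 2 * pi ->
  U [set` Interval (BSide bl a) (BSide br b)] = ((b - a) / (2 * pi))%:E.
Proof.
move=> a0 ab b2; rewrite uniform_angleE//.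
have -> : [set` Interval (BSide bl a) (BSide br b)] `&` `[0, 2 * pi]%classic
    = [set` Interval (BSide bl a) (BSide br b)] :> set R.
  apply: setIidl => t; rewrite /= !itv_boundlr/= => /andP[h1 h2].
  apply/andP; split.
    by apply: le_trans h1; rewrite bnd_simp; case: bl.
  by apply: le_trans h2 _; rewrite bnd_simp; case: br.
rewrite lebesgue_measure_itv/= lte_fin.
case: ifPn => [_|]; first by rewrite -EFinB -EFinM mulrC.
rewrite -leNgt => ba; have -> : a = b by apply/eqP; rewrite eq_le ab.
by rewrite subrr mul0r mule0.
Qed.

(** A set of angles closed under translation by [2 * pi] has the same measure
    as all its translates. *)
Lemma uniform_angle_shift A s : measurable A -> 0 <= s <= 2 * pi ->
    (forall t, A (t + 2 * pi) <-> A t) ->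
  U [set t | A (t + s)] = U A.
Proof.
move=> mA /andP[s0 s2] perA; have pi0 := @two_pi_gt0 R.
have mAs : measurable [set t | A (t + s)].
  rewrite -[X in measurable X]setTI; exact: (measurable_translation s).
rewrite !uniform_angleE//; congr (_ * _)%E.
have -> : [set t | A (t + s)] `&` `[0, 2 * pi]%classic =
    [set t | (A `&` `[s, 2 * pi + s]%classic) (t + s)].
  by apply/seteqP; split=> t /=; rewrite !in_itv/= ?lerDr ?lerD2r.
rewrite lebesgue_measure_shift; last exact: measurableI.
have -> : A `&` `[s, 2 * pi + s]%classic =
    (A `&` `[s, 2 * pi[%classic) `|` (A `&` `[2 * pi, 2 * pi + s]%classic).
  rewrite -setIUr; congr (_ `&` _); apply/seteqP; split=> t /=; rewrite !in_itv/=.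
    by move=> /andP[h1 h2]; case: (ltP t (2 * pi)) => h; [left|right]; lra.
  by move=> [|]/andP[h1 h2]; lra.
have -> : A `&` `[0, 2 * pi]%classic =
    (A `&` `[s, 2 * pi]%classic) `|` (A `&` `[0, s[%classic).
  rewrite -setIUr; congr (_ `&` _); apply/seteqP; split=> t /=; rewrite !in_itv/=.
    by move=> /andP[h1 h2]; case: (ltP t s) => h; [right|left]; lra.
  by move=> [|]/andP[h1 h2]; lra.
rewrite !measureU//; try exact: measurableI; last 2 first.
- by apply/seteqP; split=> t //=; rewrite !in_itv/= => -[[_ h1] [_ h2]]; lra.
- by apply/seteqP; split=> t //=; rewrite !in_itv/= => -[[_ h1] [_ h2]]; lra.
have null c (B : set (measurableTypeR R)) : measurable B -> B `<=` [set c] -> mu B = 0%E.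
  move=> mB Bc; apply/eqP; rewrite eq_le measure_ge0 andbT.
  by rewrite -(@lebesgue_measure_set1 _ c); apply: le_measure => //; rewrite inE.
have co a b : mu (A `&` `[a, b]%classic) = mu (A `&` `[a, b[%classic).
  have [ab|ba] := leP a b; last first.
    by rewrite !set_itv_ge// bnd_simp/= -?leNgt -?ltNge// ltW.
  have -> : A `&` `[a, b]%classic = (A `&` `[a, b[%classic) `|` (A `&` [set b]).
    rewrite -setIUr; congr (_ `&` _); apply/seteqP; split=> t /=; rewrite !in_itv/=.
      move=> /andP[h1 h2]; case: (ltP t b) => h; [left|right]; first lra.
      by apply/eqP; rewrite eq_le h2.
    by move=> [|->]; [|rewrite ab lexx]; lra.
  rewrite measureU//; try exact: measurableI; last first.
    by apply/seteqP; split=> t //=; rewrite in_itv/= => -[[_ h1] [_ h2]]; lra.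
  by rewrite [X in (_ + X)%E](null b) ?adde0//; exact: measurableI.
(* The part beyond [2 * pi] is brought back by periodicity; [co] discards the
   right endpoints, which have measure zero. *)
congr (_ + _)%E; first exact/esym/co.
rewrite [LHS]co -(lebesgue_measure_shift (2 * pi)); last exact: measurableI.
congr mu; apply/seteqP; split=> t /=; rewrite !in_itv/=.
  by move=> [/perA At h]; split=> //; lra.
by move=> [/perA At h]; split=> //; lra.
Qed.

End uniform_angle.
(** * Rotations and the uniform law on a circle *)

Section rotations.
Context {R : realType}.
Local Notation U := (uniform_prob (@two_pi_gt0 R)).
Implicit Types (p q : R * R) (r s t : R).

Lemma cosD2pi' t : cos (t + 2 * pi) = cos t :> R.
Proof. by rewrite mulr_natl cosD2pi. Qed.

Lemma sinD2pi' t : sin (t + 2 * pi) = sin t :> R.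
Proof. by rewrite mulr_natl sinD2pi. Qed.

Lemma polar_unit (x y : R) : x ^+ 2 + y ^+ 2 = 1 ->
  exists2 s, 0 <= s <= 2 * pi & cos s = x /\ sin s = y.
Proof.
move=> xy1; have pi0 := @pi_gt0 R.
have x1 : -1 <= x <= 1.
  by have y2 := sqr_ge0 y; apply/andP; split; nra.
(* [acos] reaches the upper half circle, its opposite the lower one. *)
have [y0|y0] := leP 0 y.
  exists (acos x); first by rewrite acos_ge0//=; have := acos_lepi x1; lra.
  rewrite acosK ?in_itv//= sin_acos//; split => //.
  by have -> : 1 - x ^+ 2 = y ^+ 2 by [lra]; rewrite sqrtr_sqr ger0_norm.
exists (- acos x + 2 * pi).
  by have := acos_lepi x1; have := acos_ge0 x1; lra.
rewrite cosD2pi' sinD2pi' cosN sinN acosK ?in_itv//= sin_acos//; split => //.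
by have -> : 1 - x ^+ 2 = y ^+ 2 by [lra]; rewrite sqrtr_sqr ltr0_norm ?opprK.
Qed.

Lemma polar p : exists2 s, 0 <= s <= 2 * pi & p = circle_point (enorm p) s.
Proof.
have [->|p0] := eqVneq p 0.
  exists 0; first by rewrite lexx ltW// two_pi_gt0.
  rewrite /circle_point; have -> : enorm (0 : R * R) = 0.
    by rewrite /enorm /dot/= mulr0 addr0 sqrtr0.
  by rewrite !mul0r.
have np := enorm_gt0 p0.
have [|s s2 [cs sn]] := @polar_unit (p.1 / enorm p) (p.2 / enorm p).
  rewrite !expr_div_n -mulrDl enorm_sqr /dot -!expr2 divff//.
  by have := exprn_gt0 2 np; rewrite enorm_sqr /dot -!expr2 => /lt0r_neq0.
exists s => //; rewrite /circle_point cs sn !mulrA ![enorm p * _]mulrC !mulfK ?gt_eqF//.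
by case: p {p0 np cs sn}.
Qed.

Lemma rotation_circle_point t r s :
  rotation t (circle_point r s) = circle_point r (t + s).
Proof. by rewrite /rotation /circle_point/= cosD sinD; congr pair; ring. Qed.

Lemma rotation_mod2pi t :
  exists2 s, 0 <= s <= 2 * pi & rotation s = @rotation R t.
Proof.
have [s s2 [cs sn]] := polar_unit (cos2Dsin2 t).
by exists s => //; rewrite /rotation cs sn.
Qed.

Lemma enorm_circle_point r t : 0 <= r -> enorm (circle_point r t) = r.
Proof.
move=> r0; rewrite /enorm.
have -> : dot (circle_point r t) (circle_point r t) = r ^+ 2.
  by rewrite /dot/= -[RHS]mulr1 -(cos2Dsin2 t); ring.
by rewrite sqrtr_sqr ger0_norm.
Qed.

Lemma measurable_abscissa d (T : measurableType d) (f : T -> R * R) :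
  measurable_fun setT f -> measurable_fun setT (fun x => (f x).1).
Proof. exact: measurableT_comp. Qed.

Lemma measurable_ordinate d (T : measurableType d) (f : T -> R * R) :
  measurable_fun setT f -> measurable_fun setT (fun x => (f x).2).
Proof. exact: measurableT_comp. Qed.

Lemma measurable_fun_rotation d (T : measurableType d)
    (f : T -> measurableTypeR R) (g : T -> R * R) :
  measurable_fun setT f -> measurable_fun setT g ->
  measurable_fun setT (fun x => rotation (f x) (g x)).
Proof.
move=> mf mg; have mcos : measurable_fun setT (@cos R).
  by apply: continuous_measurable_fun; exact: continuous_cos.
have msin : measurable_fun setT (@sin R).
  by apply: continuous_measurable_fun; exact: continuous_sin.
have [mg1 mg2] := (measurable_abscissa mg, measurable_ordinate mg).
have mc := measurableT_comp mcos mf; have ms := measurableT_comp msin mf.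
apply: measurable_fun_pair => /=.
  by apply: measurable_funB; apply: measurable_funM.
by apply: measurable_funD; apply: measurable_funM.
Qed.

Lemma measurable_rotation t : measurable_fun setT (@rotation R t).
Proof. by apply: measurable_fun_rotation => //; exact: measurable_id. Qed.

Lemma measurable_dot d (T : measurableType d) (f g : T -> R * R) :
  measurable_fun setT f -> measurable_fun setT g ->
  measurable_fun setT (fun x => dot (f x) (g x)).
Proof.
move=> mf mg.
have [m1 m2] := (@measurable_abscissa _ T, @measurable_ordinate _ T).
by apply: measurable_funD; apply: measurable_funM; [exact: m1|exact: m1|exact: m2|exact: m2].
Qed.

Lemma measurable_fun_subp d (T : measurableType d) (f g : T -> R * R) :
  measurable_fun setT f -> measurable_fun setT g ->
  measurable_fun setT (fun x => f x - g x).
Proof.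
move=> mf mg.
have [m1 m2] := (@measurable_abscissa _ T, @measurable_ordinate _ T).
apply: measurable_fun_pair => /=.
  by apply: measurable_funB; [exact: (m1 f)|exact: (m1 g)].
by apply: measurable_funB; [exact: (m2 f)|exact: (m2 g)].
Qed.

Lemma measurable_enorm d (T : measurableType d) (f : T -> R * R) :
  measurable_fun setT f -> measurable_fun setT (fun x => enorm (f x)).
Proof.
move=> mf; apply: (measurableT_comp (f := @Num.sqrt R)).
  by apply: continuous_measurable_fun; exact: sqrt_continuous.
exact: measurable_dot.
Qed.

Lemma measurable_lt_set d (T : measurableType d) (f g : T -> R) :
  measurable_fun setT f -> measurable_fun setT g ->
  measurable [set x | f x < g x].
Proof.
move=> mf mg; rewrite -[X in measurable X]setTI.
exact: (measurable_fun_ltr mf mg).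
Qed.

Lemma measurable_neq_set d (T : measurableType d) (f g : T -> R) :
  measurable_fun setT f -> measurable_fun setT g ->
  measurable [set x | f x != g x].
Proof.
move=> mf mg; have -> : [set x | f x != g x] =
    [set x | f x < g x] `|` [set x | g x < f x].
  by apply/seteqP; split=> x /=; rewrite neq_lt => /orP.
by apply: measurableU; exact: measurable_lt_set.
Qed.

Lemma measurable_obtuse d (T : measurableType d) (f g h : T -> R * R) :
  measurable_fun setT f -> measurable_fun setT g -> measurable_fun setT h ->
  measurable [set x | obtuse (f x) (g x) (h x)].
Proof.
move=> mf mg mh.
have -> : [set x | obtuse (f x) (g x) (h x)] =
  [set x | nondegenerate (f x) (g x) (h x)] `&`
  ([set x | dot (g x - f x) (h x - f x) < 0] `|`
   [set x | dot (h x - g x) (f x - g x) < 0] `|`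
   [set x | dot (f x - h x) (g x - h x) < 0]).
  apply/seteqP; split=> x /=.
    by move=> /obtuseP[n o]; split=> //; case: o => o; [left; left|left; right|right].
  by move=> [n o]; apply/obtuseP; split=> //;
    case: o => [[lt0|lt0]|lt0]; [apply: Or31|apply: Or32|apply: Or33].
have [m1 m2] := (@measurable_abscissa _ T, @measurable_ordinate _ T).
have mgf := measurable_fun_subp mg mf; have mhf := measurable_fun_subp mh mf.
apply: measurableI.
  apply: (@measurable_neq_set _ _
    (fun x => (g x - f x).1 * (h x - f x).2 - (g x - f x).2 * (h x - f x).1)) => //.
  apply: measurable_funB; apply: measurable_funM; by [exact: m1|exact: m2].
by apply: measurableU; [apply: measurableU|];
  apply: measurable_lt_set => //; apply: measurable_dot => //;
  apply: measurable_fun_subp.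
Qed.

(** The law of the image of a fixed point under a uniform rotation. *)
Lemma uniform_circle_spin p (A : set (R * R)) : measurable A ->
  U [set t | A (rotation t p)] = uniform_circle (enorm p) A.
Proof.
move=> mA; have [s s2 ps] := polar p.
rewrite -[RHS](@uniform_angle_shift _ _ s)//.
- by congr (U _); apply/funext => t; rewrite /= [in LHS]ps rotation_circle_point.
- by rewrite -[X in measurable X]setTI; exact: measurable_circle_point.
- by move=> t; rewrite /= /circle_point cosD2pi' sinD2pi'.
Qed.

Lemma uniform_circle_rotation r t (A : set (R * R)) : measurable A ->
  uniform_circle r [set p | A (rotation t p)] = uniform_circle r A.
Proof.
move=> mA; have [s s2 <-] := rotation_mod2pi t.
rewrite -[RHS](@uniform_angle_shift _ _ s)//.
- by congr (U _); apply/funext => u; rewrite /= rotation_circle_point addrC.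
- by rewrite -[X in measurable X]setTI; exact: measurable_circle_point.
- by move=> u; rewrite /= /circle_point cosD2pi' sinD2pi'.
Qed.

(** Only the length of [v] matters for the law of the dot product with [v]. *)
Lemma uniform_circle_dot r (v : R * R) (B : set R) : measurable B ->
  uniform_circle r [set p | B (dot p v)] =
  uniform_circle r [set p | B (enorm v * p.1)].
Proof.
move=> mB; have [s s2 vs] := polar v.
rewrite -(@uniform_circle_rotation r s); last first.
  rewrite -[X in measurable X]setTI; apply: (measurable_dot _ _ measurableT mB).
    exact: measurable_id.
  exact: measurable_cst.
congr (uniform_circle r _); apply/funext => p /=; congr B.
rewrite [in LHS]vs /dot/= -[RHS]mulr1 -(cos2Dsin2 s); ring.
Qed.

End rotations.
(** Measurability of the polynomial expressions in coordinates, dot products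
    and norms that occur below. *)
Ltac measurability :=
  lazymatch goal with
  | |- measurable_fun _ (fun _ => ?c) => exact: measurable_cst
  | |- measurable_fun _ (fun x => x) => exact: measurable_id
  | |- measurable_fun _ (fun x => dot (@?f x) (@?g x)) =>
      apply: (@measurable_dot _ _ _ f g); measurability
  | |- measurable_fun _ (fun x => enorm (@?f x)) =>
      apply: (@measurable_enorm _ _ _ f); measurability
  | |- measurable_fun _ (fun x => @?f x - @?g x) =>
      first [ apply: (@measurable_funB _ _ _ _ f g)
            | apply: (@measurable_fun_subp _ _ _ f g)]; measurability
  | |- measurable_fun _ (fun x => - @?f x) =>
      apply: (@measurable_funN _ _ _ _ f); measurability
  | |- measurable_fun _ (fun x => @?f x + @?g x) =>
      apply: (@measurable_funD _ _ _ _ f g); measurability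
  | |- measurable_fun _ (fun x => @?f x * @?g x) =>
      apply: (@measurable_funM _ _ _ _ f g); measurability
  | |- measurable_fun _ (fun x => @?f x ^+ ?n) =>
      apply: (@measurable_funX _ _ _ _ f n); measurability
  | |- measurable_fun _ (fun x => `|@?f x|) =>
      apply: (measurableT_comp (@normr_measurable _ setT) (_ : measurable_fun _ f)); measurability
  | |- measurable_fun _ (fun x => (@?f x).1) =>
      first [ exact: measurable_fst
            | apply: (@measurable_abscissa _ _ _ f); measurability
            | apply: (measurableT_comp measurable_fst); measurability ]
  | |- measurable_fun _ (fun x => (@?f x).2) =>
      first [ exact: measurable_snd
            | apply: (@measurable_ordinate _ _ _ f); measurability
            | apply: (measurableT_comp measurable_snd); measurability ]
  | |- _ => first [ assumption | done ]
  end.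

(** * Cosine of a uniform angle *)

Section cosine.
Context {R : realType}.
Local Notation U := (uniform_prob (@two_pi_gt0 R)).
Implicit Types (a b r s t y z : R).

Lemma measurable_cos : measurable_fun setT (@cos R : measurableTypeR R -> R).
Proof. by apply: continuous_measurable_fun; exact: continuous_cos. Qed.

Lemma uniform_angle_eq (A B : set (measurableTypeR R)) :
  measurable A -> measurable B ->
  (forall t, 0 <= t <= 2 * pi -> (A t <-> B t)) -> U A = U B.
Proof.
move=> mA mB AB; rewrite !uniform_angleE//; congr (_ * _)%E; congr lebesgue_measure.
by apply/seteqP; split=> t [/= h]; rewrite in_itv/= => t2; split=> //; apply/AB.
Qed.

Lemma uniform_cos_between a b : 0 <= a -> a <= b -> b <= pi ->
  U [set t | cos b < cos t < cos a] = ((b - a) / pi)%:E.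
Proof.
move=> a0 ab bpi; have pi0 := @pi_gt0 R.
(* Over a full turn each value of the cosine is taken at [t] and [2 * pi - t]. *)
transitivity (U (`]a, b[%classic `|` `]2 * pi - b, 2 * pi - a[%classic)).
  apply: uniform_angle_eq.
  - rewrite [X in measurable X](_ : _ = [set t | cos b < cos t] `&` [set t | cos t < cos a]).
      by apply: measurableI; apply: measurable_lt_set => //;
        [exact: measurable_cos|exact: measurable_cos].
    by apply/seteqP; split=> t /= => [/andP|[-> ->]].
  - exact: measurableU.
  move=> t /andP[t0 t2]; rewrite /= !in_itv/=.
  have [tpi|pit] := leP t pi.
    rewrite !ltr_cos ?in_itv//=; try by apply/andP; split; lra.
    by split=> [/andP[h1 h2]|[|]/andP[h1 h2]]; [left|..]; apply/andP; split; lra.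
  have <- : cos (- t + 2 * pi) = cos t by rewrite cosD2pi' cosN.
  rewrite !ltr_cos ?in_itv//=; try by apply/andP; split; lra.
  by split=> [/andP[h1 h2]|[|]/andP[h1 h2]]; [right|..]; apply/andP; split; lra.
rewrite measureU//; last first.
  by apply/seteqP; split=> t //=; rewrite !in_itv/= => -[/andP[? ?] /andP[? ?]]; lra.
rewrite /= !uniform_angle_itv; [|lra..].
rewrite -EFinD; congr EFin.
by move: (@pi R) pi0 {bpi} => P P0; field; rewrite gt_eqF.
Qed.

Lemma uniform_cos_eq (x : R) : U [set t | cos t = x] = 0%E.
Proof.
have pi0 := @pi_gt0 R.
have mx : measurable ([set t | cos t = x] : set (measurableTypeR R)).
  rewrite -[X in measurable X]setTI.
  exact: (measurable_cos measurableT (measurable_set1 x)).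
have [x1|x1] := boolP (-1 <= x <= 1); last first.
  rewrite (_ : [set t | cos t = x] = set0) ?measure0//.
  apply/seteqP; split=> t //= tx; move: x1; rewrite -tx.
  by rewrite cos_geN1 cos_le1.
have h1 := acos_ge0 x1; have h2 := acos_lepi x1.
rewrite (@uniform_angle_eq _ (`[acos x, acos x] `|`
  `[2 * pi - acos x, 2 * pi - acos x])%classic)//; last 2 first.
- exact: measurableU.
- move=> t t2; rewrite /= !in_itv/=; split; last first.
    move=> [|] t3; first by have -> : t = acos x; [lra|rewrite acosK].
    have -> : t = - acos x + 2 * pi by lra.
    by rewrite cosD2pi' cosN acosK.
  move=> <-; have [tpi|pit] := leP t pi.
    by left; rewrite cosK ?lexx// in_itv/=; lra.
  have <- : cos (- t + 2 * pi) = cos t by rewrite cosD2pi' cosN.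
  by right; rewrite cosK ?in_itv/=; lra.
apply/eqP; rewrite eq_le measure_ge0 andbT.
apply: (@le_trans _ _ (U `[acos x, acos x]%classic +
    U `[(2 * pi - acos x)%R, (2 * pi - acos x)%R]%classic)%E); first exact: measureU2.
rewrite /= !uniform_angle_itv; [|lra..].
by rewrite !subrr !mul0r adde0.
Qed.

(** For [z = s * sin a], the condition says that the height from the origin of
    the triangle with sides [s] and [m] enclosing the angle [t] exceeds [z]. *)
Lemma uniform_height_gt (s m a : R) : 0 < s -> s <= m -> 0 <= a <= pi / 2 ->
  U [set t | (s * m * cos t - (s * sin a) ^+ 2) ^+ 2 <
     (s ^+ 2 - (s * sin a) ^+ 2) * (m ^+ 2 - (s * sin a) ^+ 2)] =
  (1 - 2 * a / pi)%:E.
Proof.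
move=> s0 sm /andP[a0 a2]; have pi0 := @pi_gt0 R.
have m0 : 0 < m by exact: lt_le_trans sm.
have sa0 : 0 <= sin a by apply: sin_ge0_pi; lra.
have sa1 := sin_le1 a.
(* [b] is the angle for which [m * sin b = s * sin a]. *)
pose x := s * sin a / m.
have xm : x * m = s * sin a by rewrite /x divfK// gt_eqF.
have x0 : 0 <= x by rewrite /x divr_ge0// ?mulr_ge0// ltW.
have xa : x <= sin a by rewrite /x ler_pdivrMr// mulrC ler_wpM2l.
have x1 : -1 <= x <= 1 by lra.
clearbody x.
pose b := asin x; have bx : sin b = x by rewrite asinK// in_itv.
have b2 : b <= pi / 2 by exact: asin_lepi2.
have bN : - (pi / 2) <= b by exact: asin_geNpi2.
have b0 : 0 <= b.
  rewrite leNgt; apply/negP => bneg; have : sin b < sin 0.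
    by rewrite ltr_sin// in_itv/=; apply/andP; split; lra.
  by rewrite sin0 bx; lra.
have ba : b <= a.
  rewrite leNgt; apply/negP => bneg; have : sin a < sin b.
    by rewrite ltr_sin// in_itv/=; apply/andP; split; lra.
  by rewrite bx; lra.
have ca0 : 0 <= cos a by apply: cos_ge0_pihalf; lra.
have cb0 : 0 <= cos b by apply: cos_ge0_pihalf; lra.
have -> : 1 - 2 * a / pi = ((- (a + b) + pi) - (a - b)) / pi.
  by move: (@pi R) pi0 {b2 bN a2} => P P0; field; rewrite gt_eqF.
rewrite -uniform_cos_between; [|lra..].
congr (U _); apply/funext => t; apply/propext => /=.
rewrite cosDpi cosN cosD cosB bx.
have -> : (s ^+ 2 - (s * sin a) ^+ 2) * (m ^+ 2 - (s * sin a) ^+ 2) =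
    (s * m) ^+ 2 * (cos a * cos b) ^+ 2.
  rewrite -{2}xm !exprMn !cos2sin2 bx; ring.
have -> : s * m * cos t - (s * sin a) ^+ 2 = (s * m) * (cos t - sin a * x).
  by rewrite expr2 -{2}xm; ring.
rewrite exprMn ltr_pM2l ?exprn_gt0 ?mulr_gt0//.
rewrite -[X in X < _]real_normK ?num_real// ltr_pXn2r ?nnegrE ?mulr_ge0//.
by rewrite ltr_norml; split=> /andP[h1 h2]; apply/andP; split; lra.
Qed.

(** With [s] and [m] two sides of a triangle enclosing a uniform angle and [v]
    the third side, the height from their common vertex is stochastically at
    least the length of the projection of the side [s] on [v]. *)
Lemma uniform_height_projection (s m y : R) : 0 < s -> s <= m -> 0 <= y ->
  (U [set t | ((s * m) ^+ 2 - (s * m * cos t) ^+ 2 <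
     y ^+ 2 * (s ^+ 2 + m ^+ 2 - 2 * (s * m * cos t)))%R] <=
   U [set t | ((s * m * cos t - s ^+ 2) ^+ 2 <
     y ^+ 2 * (s ^+ 2 + m ^+ 2 - 2 * (s * m * cos t)))%R])%E.
Proof.
move=> s0 sm y0; have pi0 := @pi_gt0 R.
have m0 : 0 < m by exact: lt_le_trans sm.
have mcos : measurable_fun setT (fun t : measurableTypeR R => cos t) :=
  measurable_cos.
have mB1 : measurable ([set t | (s * m) ^+ 2 - (s * m * cos t) ^+ 2 <
    y ^+ 2 * (s ^+ 2 + m ^+ 2 - 2 * (s * m * cos t))] : set (measurableTypeR R)).
  by apply: measurable_lt_set; measurability.
have mB2 : measurable ([set t | (s * m * cos t - s ^+ 2) ^+ 2 <
    y ^+ 2 * (s ^+ 2 + m ^+ 2 - 2 * (s * m * cos t))] : set (measurableTypeR R)).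
  by apply: measurable_lt_set; measurability.
have [ys|sy] := ltP y s; last first.
  (* The projection never exceeds [s], and equals it only for flat triangles. *)
  set B2 := (X in (_ <= U X)%E).
  suff -> : U B2 = 1%E by exact: probability_le1.
  have le0 : (U (~` B2) <= 0)%E.
    rewrite -[leRHS]adde0 -[X in (X + _)%E](uniform_cos_eq 1).
    rewrite -[X in (_ + X)%E](uniform_cos_eq (-1)).
    have mcos_eq x : measurable ([set t | cos t = x] : set (measurableTypeR R)).
      rewrite -[X in measurable X]setTI.
      exact: (measurable_cos measurableT (measurable_set1 x)).
    apply: le_trans (measureU2 _ (mcos_eq 1) (mcos_eq (-1))).
    apply: le_measure; rewrite ?inE; [exact: measurableC|exact: measurableU|].
    move=> t; rewrite /B2 /= => /negP; rewrite -leNgt => h.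
    have q0 := sqr_ge0 (s * m * cos t - s ^+ 2).
    have y2 : s ^+ 2 <= y ^+ 2 by rewrite ler_pXn2r// nnegrE ltW.
    have w0 : 0 <= s ^+ 2 + m ^+ 2 - 2 * (s * m * cos t).
      have := cos_le1 t; have := sqr_ge0 (s - m); have := mulr_gt0 s0 m0; nra.
    have hs : (s * m) ^+ 2 * (1 - cos t ^+ 2) <= 0.
      have := ler_wpM2r w0 y2; lra.
    have : 1 - cos t ^+ 2 <= 0.
      by move: hs; rewrite pmulr_rle0// exprn_gt0// mulr_gt0.
    have := cos_le1 t; have := cos_geN1 t => c1 c2 c3.
    have /eqP : (1 - cos t) * (1 + cos t) = 0 by nra.
    by rewrite mulf_eq0 => /orP[]/eqP ?; [left|right]; lra.
  rewrite -(setCK B2) probability_setC; last exact: measurableC.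
  rewrite [X in (_ - X)%E](_ : _ = 0%E) ?sube0//.
  by apply/eqP; rewrite eq_le measure_ge0 andbT.
(* With [y = s * sin a], both probabilities are compared to [2 * a / pi]: the
   projection is less than [y] when the height exceeds [s * cos a]. *)
pose a := asin (y / s).
have ys1 : 0 <= y / s < 1 by rewrite ltr_pdivrMr// mul1r ys divr_ge0// ltW.
have sa : s * sin a = y.
  by rewrite asinK; [rewrite mulrC divfK// gt_eqF|rewrite in_itv/=; lra].
have a2 : a <= pi / 2 by apply: asin_lepi2; lra.
have aN : - (pi / 2) <= a by apply: asin_geNpi2; lra.
have a0 : 0 <= a.
  rewrite leNgt; apply/negP => aneg; have : sin a < sin 0.
    by rewrite ltr_sin// in_itv/=; apply/andP; split; lra.
  by rewrite sin0 asinK; [lra|rewrite in_itv/=; lra].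
clearbody a.
have h1 := @uniform_height_gt s m a s0 sm.
have h2 := @uniform_height_gt s m (pi / 2 - a) s0 sm.
have sca : s * sin (pi / 2 - a) = s * cos a by rewrite -opprB sinN sinBpihalf opprK.
have ca2 : (s * cos a) ^+ 2 = s ^+ 2 - y ^+ 2.
  by rewrite -sa !exprMn cos2sin2; ring.
rewrite sca ca2 in h2; rewrite sa in h1.
set B2 := (X in (_ <= U X)%E).
have -> : U B2 = (2 * a / pi)%:E.
  rewrite (_ : 2 * a / pi = 1 - 2 * (pi / 2 - a) / pi); last first.
    by move: (@pi R) pi0 {a2 aN h1 h2 sca} => P P0; field; rewrite gt_eqF.
  rewrite -h2; last lra.
  congr (U _); apply/funext => t; apply/propext; rewrite /B2 /=.
  by split; lra.
rewrite (_ : 2 * a / pi = 1 - (1 - 2 * a / pi)); last by ring.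
rewrite EFinB -h1; last lra.
rewrite -probability_setC; last by apply: measurable_lt_set; measurability.
apply: le_measure; rewrite ?inE//.
  by apply: measurableC; apply: measurable_lt_set; measurability.
by move=> t /= h; apply/negP; rewrite -leNgt; lra.
Qed.

End cosine.
(** * Sections of measurable sets in products *)

Section sections.
Context d1 d2 (T1 : measurableType d1) (T2 : measurableType d2) (R : realType).
Variables (m1 : probability T1 R) (m2 : probability T2 R).

Lemma xsection_mkset (A : set (T1 * T2)) x :
  xsection A x = [set y | A (x, y)].
Proof. by apply/funext => y; apply/propext; rewrite /xsection/= inE. Qed.

Lemma ysection_mkset (A : set (T1 * T2)) y :
  ysection A y = [set x | A (x, y)].
Proof. by apply/funext => x; apply/propext; rewrite /ysection/= inE. Qed.

Lemma measurable_section (A : set (T1 * T2)) : measurable A ->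
  measurable_fun setT (fun x => m2 [set y | A (x, y)]).
Proof.
move=> mA; have := measurable_fun_xsection m2 mA.
by apply: eq_measurable_fun => x _ /=; rewrite xsection_mkset.
Qed.

Lemma product_measureE (A : set (T1 * T2)) :
  (m1 \x m2)%E A = (\int[m1]_x m2 [set y | A (x, y)])%E.
Proof.
by rewrite /product_measure1; apply: eq_integral => x _ /=; rewrite xsection_mkset.
Qed.

(** Fubini for the indicator of a measurable set. *)
Lemma integral_section_swap (A : set (T1 * T2)) : measurable A ->
  (\int[m1]_x m2 [set y | A (x, y)] = \int[m2]_y m1 [set x | A (x, y)])%E.
Proof.
move=> mA; have := indic_fubini_tonelli m1 m2 mA.
rewrite -!/(fubini_F m2 (EFin \o \1_A)) -!/(fubini_G m1 (EFin \o \1_A)).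
rewrite indic_fubini_tonelli_FE// indic_fubini_tonelli_GE// => h.
transitivity (\int[m1]_x (m2 \o xsection A) x)%E.
  by apply: eq_integral => x _ /=; rewrite xsection_mkset.
by rewrite h; apply: eq_integral => x _ /=; rewrite ysection_mkset.
Qed.

End sections.

Section triple_sections.
Context d1 d2 d3 (T1 : measurableType d1) (T2 : measurableType d2)
  (T3 : measurableType d3) (R : realType).
Variables (m1 : probability T1 R) (m2 : probability T2 R)
  (m3 : probability T3 R).

Lemma triple_productE (A : set (T1 * T2 * T3)) : measurable A ->
  (m1 \x m2 \x m3)%E A =
  (\int[m1]_x \int[m2]_y m3 [set z | A (x, y, z)])%E.
Proof.
move=> mA; rewrite product_measureE fubini_tonelli1//.
exact: measurable_section.
Qed.

Lemma measurable_section12 (A : set (T1 * T2 * T3)) : measurable A ->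
  measurable_fun setT (fun x => \int[m2]_y m3 [set z | A (x, y, z)])%E.
Proof.
move=> mA.
apply: (@measurable_fun_fubini_tonelli_F _ _ _ _ _ m2
  (fun z => m3 [set y | A (z, y)])) => //.
exact: measurable_section.
Qed.

End triple_sections.

(** * The uniform law on a circle *)

Section circle.
Context {R : realType}.
Implicit Types (p q v : R * R) (l m r s x y : R).

Lemma uniform_circle_eq m (A B : set (R * R)) : 0 <= m ->
  (forall q, enorm q = m -> (A q <-> B q)) ->
  uniform_circle m A = uniform_circle m B.
Proof.
move=> m0 AB; rewrite /uniform_circle /distribution /pushforward.
congr (uniform_prob _ _); apply/funext => t; apply/propext.
by apply: AB; rewrite enorm_circle_point.
Qed.

(** Integrals against the uniform law on a circle only depend on the values on
    that circle. *)
Lemma le_integral_circle m (f g : R * R -> \bar R) : 0 <= m ->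
  measurable_fun setT f -> measurable_fun setT g ->
  (forall q, 0 <= f q)%E -> (forall q, 0 <= g q)%E ->
  (forall q, enorm q = m -> f q <= g q)%E ->
  (\int[uniform_circle m]_q f q <= \int[uniform_circle m]_q g q)%E.
Proof.
move=> m0 mf mg f0 g0 fg; rewrite !ge0_integral_distribution//.
apply: ge0_le_integral => //.
- by move=> t _ /=; exact: f0.
- exact: (measurableT_comp mf (measurable_circle_point m)).
- exact: (measurableT_comp mg (measurable_circle_point m)).
- by move=> t _ /=; apply: fg; rewrite enorm_circle_point.
Qed.

Lemma uniform_circle_dot_eq l v x : 0 < l -> v != 0 ->
  uniform_circle l [set q | dot q v = x] = 0%E.
Proof.
move=> l0 v0; have nv := enorm_gt0 v0.
rewrite (@uniform_circle_dot _ l v [set x])//.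
rewrite -(uniform_cos_eq (x / (enorm v * l))).
congr (uniform_prob _ _); apply/funext => t; apply/propext.
rewrite /circle_point/= mulrA; split=> [<-|->].
  by rewrite [_ * cos t]mulrC mulfK// gt_eqF// mulr_gt0.
by rewrite mulrC divfK// gt_eqF// mulr_gt0.
Qed.

(** [uniform_height_projection] for points: [`|p x q| / |q - p|] is the
    distance from the origin to the line [p q]. *)
Lemma uniform_circle_height_projection p m y : enorm p <= m -> 0 <= y ->
  (uniform_circle m [set q | ((p.1 * q.2 - p.2 * q.1) ^+ 2 <
     y ^+ 2 * dot (q - p) (q - p))%R] <=
   uniform_circle m [set q | (dot p (q - p) ^+ 2 <
     y ^+ 2 * dot (q - p) (q - p))%R])%E.
Proof.
move=> pm y0; have m0 : 0 <= m := le_trans (enorm_ge0 p) pm.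
have [->|p0] := eqVneq p 0.
  rewrite le_eqVlt; apply/orP; left; apply/eqP.
  by congr (uniform_circle m _); apply/funext => q; rewrite /dot/= !mul0r subrr addr0.
have s0 := enorm_gt0 p0; set s := enorm p in pm s0 *.
pose F1 x := (s * m) ^+ 2 - x ^+ 2; pose F2 x := (x - s ^+ 2) ^+ 2.
pose G x := y ^+ 2 * (s ^+ 2 + m ^+ 2 - 2 * x).
have mF1 : measurable [set x | F1 x < G x].
  by apply: measurable_lt_set; rewrite /F1 /G; measurability.
have mF2 : measurable [set x | F2 x < G x].
  by apply: measurable_lt_set; rewrite /F2 /G; measurability.
have E (q : R * R) : enorm q = m ->
    (dot q p ^+ 2 = (s * m) ^+ 2 - (p.1 * q.2 - p.2 * q.1) ^+ 2) /\
    (dot (q - p) (q - p) = s ^+ 2 + m ^+ 2 - 2 * dot q p).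
  move=> <-; rewrite exprMn /s !enorm_sqr /dot/=; split; ring.
rewrite (@uniform_circle_eq m _ [set q | F1 (dot q p) < G (dot q p)])//; last first.
  by move=> q /E[e1 e2]; rewrite /= /F1 /G e1 e2 subKr.
rewrite [leRHS](@uniform_circle_eq m _ [set q | F2 (dot q p) < G (dot q p)])//; last first.
  move=> q /E[e1 e2]; rewrite /= /F2 /G e2 /s enorm_sqr.
  by have -> : dot p (q - p) = dot q p - dot p p by rewrite /dot/=; ring.
rewrite (uniform_circle_dot m p mF1) [leRHS](uniform_circle_dot m p mF2).
have E2 (F : R -> R) : uniform_circle m [set q | F (s * q.1) < G (s * q.1)] =
    uniform_prob (@two_pi_gt0 R)
      [set t | F (s * m * cos t) < G (s * m * cos t)].
  congr (uniform_prob _ _); apply/funext => t.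
  by rewrite /circle_point/= mulrA.
rewrite (E2 F1) [leRHS](E2 F2).
exact: uniform_height_projection.
Qed.

End circle.
(** * At least half of the triangles are obtuse *)

Section lower_bound.
Context {R : realType}.
Implicit Types (p q v : R * R) (l m r s x y : R).

Lemma uniform_circle_dot_norm l v w (B : set R) : measurable B ->
  enorm v = enorm w ->
  uniform_circle l [set q | B (dot q v)] = uniform_circle l [set q | B (dot q w)].
Proof. by move=> mB vw; rewrite uniform_circle_dot// vw -uniform_circle_dot. Qed.

Lemma measurable_eq_set d (T : measurableType d) (f g : T -> R) :
  measurable_fun setT f -> measurable_fun setT g ->
  measurable [set x | f x = g x].
Proof.
move=> mf mg; have -> : [set x | f x = g x] = ~` [set x | f x != g x].
  by apply/seteqP; split=> x /= => [->|/negP]; [rewrite eqxx|rewrite negbK => /eqP].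
by apply: measurableC; exact: measurable_neq_set.
Qed.

Lemma uniform_circle_dot_two_sided l v x :
  (uniform_circle l [set q | (x ^+ 2 < dot q v ^+ 2)%R] =
   2%:E * uniform_circle l [set q | (`|x| < dot q v)%R])%E.
Proof.
have mgt (w : R * R) : measurable [set q | `|x| < dot q w].
  by apply: measurable_lt_set; measurability.
have -> : [set q | x ^+ 2 < dot q v ^+ 2] =
    [set q | `|x| < dot q v] `|` [set q | `|x| < dot q (- v)].
  apply/seteqP; split=> q /=; have -> : dot q (- v) = - dot q v
    by rewrite /dot/=; ring.
    rewrite -[x ^+ 2]real_normK ?num_real// -[dot q v ^+ 2]real_normK ?num_real//.
    by rewrite ltr_pXn2r ?nnegrE// ltr_normr => /orP.
  rewrite -[x ^+ 2]real_normK ?num_real// -[dot q v ^+ 2]real_normK ?num_real//.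
  by rewrite ltr_pXn2r ?nnegrE// ltr_normr => /orP.
rewrite measureU//; last first.
  apply/seteqP; split=> // q [/= h1 h2]; have := normr_ge0 x.
  by have e : dot q (- v) = - dot q v; [rewrite /dot/=; ring|lra].
rewrite /= (_ : 2%:E = 1 + 1)%E// ge0_muleDl// mul1e; congr (_ + _)%E.
apply: (@uniform_circle_dot_norm _ _ _ [set y | `|x| < y]).
  by apply: measurable_lt_set; measurability.
by rewrite /enorm /dot/= !mulrNN.
Qed.

(** The triangle [p q r] is obtuse at [p] or [q] when [r] projects on the line
    [p q] outside of the segment [p q]. Replacing [dot p (q - p)] by
    minus its absolute value only makes this rarer, and then the two sides of
    each band are equally likely, whence the factor [2]. The second band is
    taken along the other axis for [uniform_circle_height_cover]. *)
Lemma obtuse_two_sided p q l : 0 < l -> enorm p <= enorm q ->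
  (uniform_circle l
     [set r | (dot p (q - p) ^+ 2 < r.1 ^+ 2 * dot (q - p) (q - p))%R] +
   uniform_circle l
     [set r | (dot q (q - p) ^+ 2 < r.2 ^+ 2 * dot (q - p) (q - p))%R] <=
   2%:E * uniform_circle l [set r | obtuse p q r])%E.
Proof.
move=> l0 pq; set v := q - p.
have [v0|v0] := eqVneq v 0.
  have e (f : R * R -> R) x : [set r | x ^+ 2 < f r ^+ 2 * dot v v] = set0.
    apply/seteqP; split=> // r /=; rewrite v0 /dot/= mulr0 addr0 mulr0 => h.
    by have := sqr_ge0 x; lra.
  by rewrite (e fst) (e snd) !measure0 adde0 mule_ge0.
have nv := enorm_gt0 v0.
have msq x : measurable [set y : R | x ^+ 2 < (enorm v * y) ^+ 2].
  by apply: measurable_lt_set; measurability.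
have mlt x : measurable [set y : R | x ^+ 2 < y ^+ 2].
  by apply: measurable_lt_set; measurability.
have e1 x : uniform_circle l [set r | x ^+ 2 < r.1 ^+ 2 * dot v v] =
    (2%:E * uniform_circle l [set r | (`|x| < dot r v)%R])%E.
  rewrite -uniform_circle_dot_two_sided (uniform_circle_dot l v (mlt x)).
  congr (uniform_circle l _); apply/funext => r /=.
  by rewrite exprMn enorm_sqr mulrC.
have e2 x : uniform_circle l [set r | x ^+ 2 < r.2 ^+ 2 * dot v v] =
    uniform_circle l [set r | x ^+ 2 < r.1 ^+ 2 * dot v v].
  transitivity (uniform_circle l [set r | x ^+ 2 < (enorm v * dot r (0, 1)) ^+ 2]).
    congr (uniform_circle l _); apply/funext => r /=.
    by rewrite exprMn enorm_sqr mulrC /dot/= mulr0 add0r mulr1.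
  rewrite (@uniform_circle_dot_norm l _ (1, 0) _ (msq x)); last first.
    by rewrite /enorm /dot/= !mulr0 !mulr1 addr0 add0r.
  congr (uniform_circle l _); apply/funext => r /=.
  by rewrite exprMn enorm_sqr mulrC /dot/= mulr0 addr0 mulr1.
rewrite e2 !e1 -ge0_muleDr// lee_wpmul2l//.
have mgt x w : measurable [set r | x < dot r w].
  by apply: measurable_lt_set; measurability.
have mltd x w : measurable [set r | dot r w < x].
  by apply: measurable_lt_set; measurability.
(* The triangle is degenerate when [r - p] is orthogonal to [u]. *)
pose u : R * R := (- v.2, v.1).
have u0 : u != 0.
  apply/eqP => -[/eqP + v1]; rewrite oppr_eq0 => /eqP v2.
  by move/eqP: v0; apply; apply: injective_projections.
apply: (@le_trans _ _ (uniform_circle l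
    ([set r | dot r v < dot p v] `|` [set r | dot q v < dot r v]))).
  rewrite measureU//; last first.
    apply/seteqP; split=> // r [/= h1 h2].
    have : dot v v = dot q v - dot p v by rewrite /v /dot/=; ring.
    by have := dotpp_ge0 v; lra.
  apply: leeD.
    rewrite (@uniform_circle_dot_norm l _ (- v) [set y | `|dot p v| < y]); first last.
    - by rewrite /enorm /dot/= !mulrNN.
    - by apply: measurable_lt_set; measurability.
    apply: le_measure; rewrite ?inE//; first exact: mgt.
    move=> r /=; have -> : dot r (- v) = - dot r v by rewrite /dot/=; ring.
    by rewrite ltr_norml; lra.
  apply: le_measure; rewrite ?inE//.
  by move=> r /=; rewrite ltr_norml => /andP[].
have mobt : measurable [set r | obtuse p q r].
  by apply: measurable_obtuse; [exact: measurable_cst|exact: measurable_cst|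
    exact: measurable_id].
have meq : measurable [set r | dot r u = dot p u].
  by apply: measurable_eq_set; measurability.
apply: (@le_trans _ _ (uniform_circle l
    ([set r | obtuse p q r] `|` [set r | dot r u = dot p u]))).
  apply: le_measure; rewrite ?inE; [exact: measurableU|exact: measurableU|].
  move=> r h; have [e|n] := eqVneq (dot r u) (dot p u); [by right|left].
  apply/obtuseP; split.
    rewrite /nondegenerate; apply: contra_neq n => n.
    by move: n; rewrite /dot /u /v/=; lra.
  have d1 : dot (q - p) (r - p) = dot r v - dot p v by rewrite /v /dot/=; ring.
  have d2 : dot (r - q) (p - q) = dot q v - dot r v by rewrite /v /dot/=; ring.
  by case: h => /= h; [apply: Or31|apply: Or32]; lra.
apply: (le_trans (measureU2 _ mobt meq)).
by rewrite [X in (_ + X)%E]uniform_circle_dot_eq// adde0.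
Qed.

(** For [r] on the circle of radius [l], the two conditions cannot both fail,
    except when [r.1] is plus or minus the height: the squares of the height
    and of the projection of [q] add up to [enorm q ^+ 2 <= l ^+ 2]. *)
Lemma uniform_circle_height_cover p q l : 0 < l -> enorm q <= l -> q != p ->
  (1 <= uniform_circle l
     [set r | ((p.1 * q.2 - p.2 * q.1) ^+ 2 <
        r.1 ^+ 2 * dot (q - p) (q - p))%R] +
   uniform_circle l
     [set r | (dot q (q - p) ^+ 2 < r.2 ^+ 2 * dot (q - p) (q - p))%R])%E.
Proof.
rewrite -subr_eq0 => l0 ql; set v := q - p => v0.
have nv := enorm_gt0 v0.
set h := p.1 * q.2 - p.2 * q.1; pose e : R * R := (1, 0).
have e0 : e != 0 by apply/eqP => -[] /eqP; rewrite oner_eq0.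
set A := [set r | h ^+ 2 < _]; set B := [set r | dot q v ^+ 2 < _].
have mA : measurable A by apply: measurable_lt_set; measurability.
have mB : measurable B by apply: measurable_lt_set; measurability.
pose N x := [set r | dot r e = x].
have mN x : measurable (N x).
  by apply: measurable_eq_set; measurability.
have N0 x : uniform_circle l (N x) = 0%E by exact: uniform_circle_dot_eq.
pose C := A `|` B `|` N (h / enorm v) `|` N (- (h / enorm v)).
have mC : measurable C by repeat apply: measurableU => //.
have <- : uniform_circle l C = 1%E.
  rewrite -(probability_setT (uniform_circle l)).
  apply: uniform_circle_eq; first exact: ltW.
  move=> r rl; split=> // _.
  rewrite /C /setU/= /A /B /=.
  have [hA|nA] := ltP (h ^+ 2) (r.1 ^+ 2 * dot v v); first by do 3 left.
  have [hB|nB] := ltP (dot q v ^+ 2) (r.2 ^+ 2 * dot v v); first by left; left; right.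
  have k1 : (r.1 ^+ 2 + r.2 ^+ 2) * dot v v = l ^+ 2 * dot v v.
    by rewrite -rl enorm_sqr /dot -!expr2.
  have k2 : dot q v ^+ 2 + h ^+ 2 = enorm q ^+ 2 * dot v v.
    by rewrite enorm_sqr /h /v /dot/=; ring.
  have k3 : enorm q ^+ 2 * dot v v <= l ^+ 2 * dot v v.
    by rewrite ler_wpM2r ?dotpp_ge0// ler_pXn2r// nnegrE ?enorm_ge0// ltW.
  have /eqP : (r.1 - h / enorm v) * (r.1 + h / enorm v) = 0.
    rewrite -subr_sqr expr_div_n enorm_sqr.
    have dv : 0 < dot v v by rewrite -enorm_sqr exprn_gt0.
    by rewrite (_ : h ^+ 2 = r.1 ^+ 2 * dot v v); [rewrite mulfK ?gt_eqF// subrr|lra].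
  have re : dot r e = r.1 by rewrite /dot/= mulr1 mulr0 addr0.
  by rewrite mulf_eq0 => /orP[] /eqP h0; [left; right|right]; rewrite /N/= re; lra.
have mAB : measurable (A `|` B) by exact: measurableU.
have mABN : measurable (A `|` B `|` N (h / enorm v)) by exact: measurableU.
apply: (le_trans (measureU2 _ mABN (mN _))); rewrite [X in (_ + X)%E]N0 adde0.
apply: (le_trans (measureU2 _ mAB (mN _))); rewrite [X in (_ + X)%E]N0 adde0.
exact: measureU2.
Qed.

Lemma measurable_neq p : measurable [set q | q != p].
Proof.
rewrite (_ : mkset _ = [set q | q.1 != p.1] `|` [set q | q.2 != p.2]).
  by apply: measurableU; apply: measurable_neq_set; measurability.
apply/seteqP; split=> q /=; case: q => a b; case: (p) => c f /=;
  by rewrite xpair_eqE negb_and => /orP.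
Qed.

Lemma uniform_circle_neq m p : 0 < m -> uniform_circle m [set q | q != p] = 1%E.
Proof.
move=> m0; pose e : R * R := (1, 0).
have e0 : e != 0 by apply/eqP => -[] /eqP; rewrite oner_eq0.
have mN : measurable [set q | dot q e = dot p e].
  by apply: measurable_eq_set; measurability.
have mneq := measurable_neq p.
apply/eqP; rewrite eq_le probability_le1//=.
have -> : 1%E = uniform_circle m (~` [set q | dot q e = dot p e]) :> \bar R.
  by rewrite probability_setC// [X in (_ - X)%E]uniform_circle_dot_eq ?sube0.
apply: le_measure; rewrite ?inE//; first exact: measurableC.
by move=> q /= h; apply: contra_notN h => /eqP ->.
Qed.

(** The lower bound for a fixed position [p] of the innermost vertex. The sets
    [A], [B] and [C] below express that [r] leaves the band given by the
    projection of [p], by the projection of [q], and by the height. *)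
Lemma circle_pair_obtuse p m l : enorm p <= m -> 0 < m -> m <= l ->
  (1 <= 2%:E * \int[uniform_circle m]_q
     uniform_circle l [set r | obtuse p q r])%E.
Proof.
move=> pm m0 ml; have l0 : 0 < l by exact: lt_le_trans ml.
pose P := (R * R)%type; pose W (z : P * P) := dot (z.1 - p) (z.1 - p).
have mW : measurable_fun setT W by rewrite /W; measurability.
pose A := [set z : P * P | dot p (z.1 - p) ^+ 2 < z.2.1 ^+ 2 * W z].
pose C := [set z : P * P | (p.1 * z.1.2 - p.2 * z.1.1) ^+ 2 < z.2.1 ^+ 2 * W z].
pose B := [set z : P * P | dot z.1 (z.1 - p) ^+ 2 < z.2.2 ^+ 2 * W z].
pose O := [set z : P * P | obtuse p z.1 z.2].
have mA : measurable A by apply: measurable_lt_set; measurability.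
have mB : measurable B by apply: measurable_lt_set; measurability.
have mC : measurable C by apply: measurable_lt_set; measurability.
have mO : measurable O.
  by apply: measurable_obtuse => //; exact: measurable_cst.
have ms (D : set (P * P)) : measurable D -> measurable_fun setT
    (fun q => uniform_circle l [set r | D (q, r)]) by exact: measurable_section.
rewrite -ge0_integralZl//; last exact: (ms O).
have AB : (\int[uniform_circle m]_q
      (uniform_circle l [set r | A (q, r)] + uniform_circle l [set r | B (q, r)]) <=
    \int[uniform_circle m]_q (2%:E * uniform_circle l [set r | obtuse p q r]))%E.
  apply: le_integral_circle => //; first exact: le_trans (enorm_ge0 p) pm.
  - by apply: emeasurable_funD; exact: ms.
  - by apply: measurable_funeM; exact: (ms O).
  - by move=> q; rewrite adde_ge0.
  - by move=> q; rewrite mule_ge0.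
  by move=> q qm; apply: obtuse_two_sided; rewrite ?qm.
refine (le_trans _ AB); rewrite ge0_integralD//; [|exact: ms|exact: ms].
(* Fubini, to compare the projection of [p] with the height for fixed [r]. *)
have CA : (\int[uniform_circle m]_q uniform_circle l [set r | C (q, r)] <=
    \int[uniform_circle m]_q uniform_circle l [set r | A (q, r)])%E.
  rewrite (integral_section_swap (uniform_circle m) (uniform_circle l) mC).
  rewrite (integral_section_swap (uniform_circle m) (uniform_circle l) mA).
  have msy (D : set (P * P)) : measurable D -> measurable_fun setT
      (fun r : R * R => uniform_circle m [set q | D (q, r)]).
    move=> mD; have := measurable_fun_ysection (uniform_circle m) mD.
    by apply: eq_measurable_fun => x _ /=; rewrite ysection_mkset.
  apply: ge0_le_integral => //; [exact: msy|exact: msy|].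
  move=> r _; have := uniform_circle_height_projection pm (normr_ge0 r.1).
  by rewrite real_normK ?num_real.
refine (le_trans _ (leeD CA (lexx _))).
rewrite -ge0_integralD//; [|exact: ms|exact: ms].
have mneq := measurable_neq p.
rewrite -(@uniform_circle_neq m p m0) -[X in uniform_circle m X]setIT -integral_indic//.
apply: le_integral_circle => //; first exact: le_trans (enorm_ge0 p) pm.
- exact/measurable_EFinP.
- by apply: emeasurable_funD; exact: ms.
- by move=> q; rewrite adde_ge0.
move=> q qm; rewrite indicE; case: (boolP (q \in _)) => [|_]; last by rewrite adde_ge0.
rewrite inE/= => qp; apply: uniform_circle_height_cover => //.
by rewrite qm.
Qed.

Theorem half_le_obtuse s m l : 0 <= s -> s <= m -> m <= l -> 0 < m ->
  (1 <= 2%:E * (uniform_circle s \x uniform_circle m \x uniform_circle l)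
          [set z : (R * R) * (R * R) * (R * R) | obtuse z.1.1 z.1.2 z.2])%E.
Proof.
move=> s0 sm ml m0.
have mO : measurable [set z : (R * R) * (R * R) * (R * R) | obtuse z.1.1 z.1.2 z.2].
  by apply: measurable_obtuse; measurability.
rewrite triple_productE// -ge0_integralZl//; last first.
- by move=> p _; apply: integral_ge0.
- exact: (measurable_section12 _ _ mO).
rewrite -(probability_setT (uniform_circle s)) -[leLHS]mul1e -integral_cst//.
apply: le_integral_circle => //.
- by apply: measurable_funeM; exact: (measurable_section12 _ _ mO).
- by move=> p; rewrite mule_ge0// integral_ge0.
by move=> p ps; apply: circle_pair_obtuse => //; rewrite ps.
Qed.

End lower_bound.
(** * Acute triangles occur with positive probability *)

Section upper_bound.
Context {R : realType}.
Local Notation U := (uniform_prob (@two_pi_gt0 R)).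
Implicit Types (p q r v : R * R) (l m s x y : R).

Lemma uniform_cos_pos x : 0 < x <= 1 -> (0 < U [set t | (0 < cos t < x)%R])%E.
Proof.
move=> /andP[x0 x1]; have pi0 := @pi_gt0 R.
have x11 : -1 <= x <= 1 by lra.
have a0 := acos_ge0 x11; have api := acos_lepi x11.
have a2 : acos x < pi / 2.
  rewrite ltNge; apply/negP => h; have : cos (acos x) <= cos (pi / 2).
    have [->//|ne] := eqVneq (acos x) (pi / 2).
    rewrite ltW// ltr_cos ?in_itv/=; try by apply/andP; split; lra.
    by rewrite lt_neqAle eq_sym ne.
  by rewrite cos_pihalf acosK ?in_itv/=; lra.
have -> : [set t | 0 < cos t < x] = [set t | cos (pi / 2) < cos t < cos (acos x)].
  by rewrite cos_pihalf acosK// in_itv.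
rewrite uniform_cos_between; [|lra..].
by rewrite lte_fin divr_gt0// subr_gt0.
Qed.

Lemma rotation_pi p : rotation pi p = - p.
Proof. by rewrite /rotation cospi sinpi !mul0r subr0 add0r !mulN1r. Qed.

(** A sufficient condition for all three angles to be at most a right angle. *)
Lemma not_obtuse p q r m : enorm p = m -> m <= enorm q ->
  0 < dot p q -> dot p q < m ^+ 2 / 2 ->
  `|dot r (p - q)| <= m ^+ 2 / 2 -> dot r (p + q) <= 0 -> ~ obtuse p q r.
Proof.
move=> pm mq pq0 pqm; rewrite ler_norml => /andP[h1 h2] h3 /obtuseP[_].
have pp : dot p p = m ^+ 2 by rewrite -enorm_sqr pm.
have qq : m ^+ 2 <= dot q q.
  by rewrite -enorm_sqr ler_pXn2r// nnegrE ?enorm_ge0// -pm enorm_ge0.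
have rr := dotpp_ge0 r.
have e1 : dot (q - p) (r - p) = dot r (- (p - q)) + dot p p - dot p q.
  by rewrite /dot/=; ring.
have e2 : dot (r - q) (p - q) = dot r (p - q) + dot q q - dot p q.
  by rewrite /dot/=; ring.
have e3 : dot (p - r) (q - r) = dot p q + dot r r - dot r (p + q).
  by rewrite /dot/=; ring.
have e4 : dot r (- (p - q)) = - dot r (p - q) by rewrite /dot/=; ring.
by case; rewrite ?e1 ?e2 ?e3 ?e4; lra.
Qed.

(** By the half-turn, a point [r] nearly orthogonal to [p - q] has at least one
    chance in two to lie on the side opposite to [p + q]. The bound on [cos t]
    makes [enorm (p - q) * (s * cos t)], whose law is that of [dot r (p - q)],
    at most [m ^+ 2 / 2]. *)
Lemma uniform_circle_not_obtuse p q s m l : 0 <= s -> s <= m -> 0 < m ->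
  m <= l -> enorm p = m -> enorm q = l -> 0 < dot p q -> dot p q < m ^+ 2 / 2 ->
  (U [set t | (0 < cos t < m / (2 * (m + l)))%R] <=
    2%:E * uniform_circle s [set r | ~ obtuse p q r])%E.
Proof.
move=> s0 sm m0 ml pm ql pq0 pqm; set w := p - q; set c := m ^+ 2 / 2.
have c0 : 0 < c by rewrite divr_gt0// exprn_gt0.
have wl : enorm w <= m + l.
  rewrite -(@ler_pXn2r _ 2)// ?nnegrE ?enorm_ge0//; last lra.
  have -> : enorm w ^+ 2 = enorm p ^+ 2 + enorm q ^+ 2 - 2 * dot p q.
    by rewrite !enorm_sqr /dot/=; ring.
  by rewrite pm ql; nra.
have mD : measurable [set y : R | `|y| <= c].
  rewrite (_ : mkset _ = ~` [set y : R | c < `|y|]).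
    by apply: measurableC; apply: measurable_lt_set; measurability.
  by apply/seteqP; split=> y /=; [move=> h; apply/negP|move/negP]; rewrite -leNgt.
have mN : measurable [set r | ~ obtuse p q r].
  by apply: measurableC; apply: measurable_obtuse;
    [exact: measurable_cst|exact: measurable_cst|exact: measurable_id].
have mNr : measurable [set r | ~ obtuse p q (rotation pi r)].
  rewrite -[X in measurable X]setTI.
  exact: (measurable_rotation pi measurableT mN).
have mE : measurable [set r | [set y : R | `|y| <= c] (dot r w)].
  rewrite -[X in measurable X]setTI.
  have mdw : measurable_fun setT (fun r => dot r w) by measurability.
  exact: (mdw measurableT _ mD).
have h : (uniform_circle s [set r | [set y : R | (`|y| <= c)%R] (dot r w)] <=
    2%:E * uniform_circle s [set r | ~ obtuse p q r])%E.
  rewrite (_ : 2%:E = 1 + 1)%E// ge0_muleDl// mul1e.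
  rewrite -[X in (_ + X)%E](@uniform_circle_rotation _ s pi)//.
  refine (le_trans _ (measureU2 _ mN mNr)).
  apply: le_measure; rewrite ?inE//; first exact: measurableU.
  move=> r /= rw; have [h|h] := leP (dot r (p + q)) 0; [left|right].
    by apply: (@not_obtuse p q r m) => //; rewrite ql.
  apply: (@not_obtuse p q _ m) => //; rewrite ?ql// rotation_pi.
    by have -> : dot (- r) w = - dot r w; [rewrite /dot/=; ring|rewrite normrN].
  by have -> : dot (- r) (p + q) = - dot r (p + q); [rewrite /dot/=; ring|lra].
refine (le_trans _ h).
rewrite (@uniform_circle_dot _ s w _ mD) /uniform_circle /distribution /pushforward.
have mcos : measurable_fun setT (fun t : measurableTypeR R => cos t) :=
  measurable_cos.
apply: le_measure; rewrite ?inE//.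
- rewrite (_ : mkset _ = [set t | 0 < cos t] `&`
      [set t | cos t < m / (2 * (m + l))]).
    by apply: measurableI; apply: measurable_lt_set; measurability.
  by apply/seteqP; split=> t /= => [/andP|[-> ->]].
- rewrite -[X in measurable X]setTI.
  apply: (measurable_circle_point s measurableT).
  rewrite -[X in measurable X]setTI.
  have mw : measurable_fun setT (fun r : R * R => enorm w * r.1) by measurability.
  exact: (mw measurableT _ mD).
move=> t /= /andP[t0 t1]; rewrite mulrA ger0_norm; last first.
  by rewrite !mulr_ge0// ?enorm_ge0// ltW.
apply: (@le_trans _ _ ((m + l) * m * (m / (2 * (m + l))))).
  rewrite ler_pM ?mulr_ge0 ?enorm_ge0//; [exact: ltW| |exact: ltW].
  by rewrite ler_pM// enorm_ge0.
rewrite /c le_eqVlt; apply/orP; left; apply/eqP; field.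
by rewrite gt_eqF//; lra.
Qed.

Local Notation obtuse_set :=
  [set z : (R * R) * (R * R) * (R * R) | obtuse z.1.1 z.1.2 z.2].

(** The probability of which [P_obt] is the real part. *)
Definition prob_obtuse (r1 r2 r3 : R) : \bar R :=
  ((uniform_circle r1 \x uniform_circle r2 \x uniform_circle r3)%E obtuse_set).

Lemma measurable_obtuse_set : measurable obtuse_set.
Proof. by apply: measurable_obtuse; measurability. Qed.

(** The strict upper bound for sorted radii; the vertex on the smallest circle
    comes last, as its position is chosen given the two others. *)
Lemma obtuse_lt1_aux s m l : 0 <= s -> s <= m -> 0 < m -> m <= l ->
  (prob_obtuse m l s < 1)%E.
Proof.
move=> s0 sm m0 ml; have l0 : 0 < l by lra.
have mO := measurable_obtuse_set.
(* [k'] bounds from below the chance that [0 < dot p q < m ^+ 2 / 2], and [k]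
   twice that of a triangle without obtuse angle given such [p] and [q]. *)
pose k := U [set t | 0 < cos t < m / (2 * (m + l))].
pose k' := U [set t | 0 < cos t < m / (2 * l)].
have k0 : (0 < k)%E.
  apply: uniform_cos_pos; rewrite divr_gt0//=; last lra.
  by rewrite ler_pdivrMr; lra.
have k'0 : (0 < k')%E.
  apply: uniform_cos_pos; rewrite divr_gt0//=; last lra.
  by rewrite ler_pdivrMr; lra.
have mC := measurableC mO; rewrite /prob_obtuse.
suff : (k * k' <= 2%:E * (uniform_circle m \x uniform_circle l \x uniform_circle s)
    (~` obtuse_set))%E.
  move=> h; have : (0 < 2%:E * (uniform_circle m \x uniform_circle l \x
      uniform_circle s) (~` obtuse_set))%E by exact: lt_le_trans (mule_gt0 k0 k'0) h.
  rewrite pmule_rgt0// => pos; rewrite -(setCK obtuse_set) probability_setC//.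
  set x := (X in (1 - X)%E); have xfin : x \is a fin_num by exact: fin_num_measure.
  have {pos} : (0 < x)%E by exact: pos.
  by rewrite -(fineK xfin) -EFinB !lte_fin; lra.
rewrite triple_productE// -[leRHS]ge0_integralZl//; last 2 first.
- exact: (measurable_section12 _ _ mC).
- by move=> p _; apply: integral_ge0.
rewrite -[leLHS]mule1 -[X in (_ * X <= _)%E](probability_setT (uniform_circle m)) -integral_cst//.
have msC p : measurable_fun setT
    (fun q => uniform_circle s [set r | ~ obtuse p q r]).
  apply: (@measurable_section _ _ _ _ _ (uniform_circle s)
    [set z | ~ obtuse p z.1 z.2]).
  by apply: measurableC; apply: measurable_obtuse;
    [exact: measurable_cst|exact: measurable_fst|exact: measurable_snd].
apply: le_integral_circle => //; first exact: ltW.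
- by apply: measurable_funeM; exact: (measurable_section12 _ _ mC).
- by move=> p; rewrite /= mule_ge0// ltW.
- by move=> p; rewrite mule_ge0// integral_ge0.
move=> p pm; rewrite -[leRHS]ge0_integralZl//; last exact: (msC p).
pose E := [set y : R | 0 < y < m ^+ 2 / 2].
have mE : measurable E.
  rewrite (_ : E = [set y | 0 < y] `&` [set y | y < m ^+ 2 / 2]).
    by apply: measurableI; apply: measurable_lt_set; measurability.
  by apply/seteqP; split=> t /= => [/andP|[h1 h2]] //; apply/andP.
have mdp : measurable_fun setT (fun q => dot q p) by measurability.
have mEp : measurable [set q | E (dot q p)].
  by rewrite -[X in measurable X]setTI; exact: (mdp measurableT _ mE).
have k'E : (k' <= uniform_circle l [set q | E (dot q p)])%E.
  rewrite (uniform_circle_dot l p mE) pm.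
  rewrite le_eqVlt; apply/orP; left; apply/eqP.
  rewrite /k' /uniform_circle /distribution /pushforward.
  congr (U _); apply/funext => t; apply/propext; rewrite /E /circle_point/=.
  rewrite mulrA pmulr_rgt0 ?mulr_gt0//.
  have -> : m ^+ 2 / 2 = m * l * (m / (2 * l)) by field; rewrite gt_eqF.
  by rewrite ltr_pM2l// mulr_gt0.
refine (le_trans (lee_wpmul2l _ k'E) _); first exact: ltW.
rewrite -[X in uniform_circle l X]setIT -integral_indic// -[leLHS]ge0_integralZl//; last 2 first.
- exact/measurable_EFinP.
- exact: ltW.
apply: le_integral_circle => //; first exact: ltW.
- by apply: measurable_funeM; exact/measurable_EFinP.
- by apply: measurable_funeM; exact: (msC p).
- by move=> q; rewrite mule_ge0// ltW.
- by move=> q; rewrite mule_ge0.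
move=> q ql; rewrite indicE; case: (boolP (q \in _)) => [|_]; last first.
  by rewrite mule0 mule_ge0.
rewrite inE/= /E/= dotC => /andP[e1 e2]; rewrite mule1.
exact: (@uniform_circle_not_obtuse p q s m l).
Qed.

Lemma prob_obtuseE (r1 r2 r3 : R) : prob_obtuse r1 r2 r3 =
  (\int[uniform_circle r1]_p \int[uniform_circle r2]_q
     uniform_circle r3 [set r | obtuse p q r])%E.
Proof. exact: (triple_productE _ _ _ measurable_obtuse_set). Qed.

Lemma prob_obtuse_swap23 (r1 r2 r3 : R) : prob_obtuse r1 r2 r3 = prob_obtuse r1 r3 r2.
Proof.
rewrite !prob_obtuseE; apply: eq_integral => p _.
pose A := [set z : (R * R) * (R * R) | obtuse p z.1 z.2].
have mA : measurable A.
  by apply: measurable_obtuse; [exact: measurable_cst|exact: measurable_fst|exact: measurable_snd].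
transitivity (\int[uniform_circle r3]_r uniform_circle r2 [set q | A (q, r)])%E.
  exact: (integral_section_swap (uniform_circle r2) (uniform_circle r3) mA).
apply: eq_integral => q _; congr (uniform_circle r2 _).
by apply/seteqP; split=> r; exact: obtuse_swap23.
Qed.

Lemma prob_obtuse_swap12 (r1 r2 r3 : R) : prob_obtuse r1 r2 r3 = prob_obtuse r2 r1 r3.
Proof.
have mO := measurable_obtuse_set.
rewrite !prob_obtuseE.
pose f (z : (R * R) * (R * R)) := uniform_circle r3 [set r | obtuse_set (z, r)].
have mf : measurable_fun setT f by exact: measurable_section.
transitivity (\int[uniform_circle r2]_q \int[uniform_circle r1]_p f (p, q))%E.
  exact: (fubini_tonelli f).
apply: eq_integral => p _; apply: eq_integral => q _; congr (uniform_circle r3 _).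
by apply/seteqP; split=> r; exact: obtuse_swap12.
Qed.

(** The bounds do not depend on the order of the radii. *)
Theorem prob_obtuse_bounds (r1 r2 r3 : R) : 0 <= r1 -> 0 <= r2 -> 0 <= r3 ->
  0 < r1 + r2 -> 0 < r1 + r3 -> 0 < r2 + r3 ->
  (1 <= 2%:E * prob_obtuse r1 r2 r3 /\ prob_obtuse r1 r2 r3 < 1)%E.
Proof.
have sorted s m l : 0 <= s -> s <= m -> m <= l -> 0 < s + m ->
    (1 <= 2%:E * prob_obtuse s m l /\ prob_obtuse s m l < 1)%E.
  move=> s0 sm ml sm0; have m0 : 0 < m by lra.
  split; first exact: half_le_obtuse.
  by rewrite prob_obtuse_swap12 prob_obtuse_swap23; exact: obtuse_lt1_aux.
move=> r10 r20 r30 r12 r13 r23.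
have [h12|h12] := leP r1 r2; have [h13|h13] := leP r1 r3; have [h23|h23] := leP r2 r3.
- exact: sorted.
- by rewrite prob_obtuse_swap23; apply: sorted => //; exact: ltW.
- by exfalso; lra.
- rewrite prob_obtuse_swap23 prob_obtuse_swap12; apply: sorted => //; first exact: ltW.
  by rewrite addrC.
- by rewrite prob_obtuse_swap12; apply: sorted => //; [exact: ltW|rewrite addrC].
- by exfalso; lra.
- rewrite prob_obtuse_swap12 prob_obtuse_swap23; apply: sorted => //; exact: ltW.
- rewrite prob_obtuse_swap12 prob_obtuse_swap23 prob_obtuse_swap12.
  by apply: sorted => //; [exact: ltW|exact: ltW|rewrite addrC].
Qed.

End upper_bound.
(** * Averaging over independent rotations *)

Section box_unique.
Context d1 d2 (T1 : measurableType d1) (T2 : measurableType d2) (R : realType).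

Lemma measure_rectangle_unique (m1 m2 : {measure set (T1 * T2) -> \bar R}) :
  (m1 setT < +oo)%E ->
  (forall A B, measurable A -> measurable B -> m1 (A `*` B) = m2 (A `*` B)) ->
  forall X, measurable X -> m1 X = m2 X.
Proof.
move=> m1oo m12 X mX.
apply: (measure_unique [set A `*` B | A in measurable & B in measurable]
  (fun=> setT)) => //.
- exact: measurable_prod_measurableType.
- move=> _ _ [A1 mA1 [B1 mB1 <-]] [A2 mA2 [B2 mB2 <-]].
  exists (A1 `&` A2); first exact: measurableI.
  by exists (B1 `&` B2); [exact: measurableI|rewrite setXI].
- by move=> _; exists setT => //; exists setT => //; rewrite setXTT.
- by rewrite bigcup_const//; exists 0%N.
- by move=> _ [A mA [B mB <-]]; exact: m12.
Qed.

End box_unique.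

Section box_unique3.
Context d1 d2 d3 (T1 : measurableType d1) (T2 : measurableType d2)
  (T3 : measurableType d3) (R : realType).

Lemma measure_box_unique (m1 m2 : {measure set (T1 * T2 * T3) -> \bar R}) :
  (m1 setT < +oo)%E ->
  (forall A B C, measurable A -> measurable B -> measurable C ->
     m1 (A `*` B `*` C) = m2 (A `*` B `*` C)) ->
  forall X, measurable X -> m1 X = m2 X.
Proof.
move=> m1oo m12; apply: measure_rectangle_unique => // S C mS mC.
have mTC : measurable ([set: T1 * T2] `*` C) by exact: measurableX.
pose n (m : {measure set (T1 * T2 * T3) -> \bar R}) :=
  pushforward (mrestr m mTC) (@fst (T1 * T2) T3).
have nE (m : {measure set (T1 * T2 * T3) -> \bar R}) D : n m D = m (D `*` C).
  rewrite /n /pushforward /mrestr; congr (m _).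
  by apply/seteqP; split=> -[z c] /= => [[? [? ?]]|[? ?]].
rewrite -!nE; apply: measure_rectangle_unique => //.
- suff : (n m1 setT < +oo)%E by exact.
  rewrite nE; apply: le_lt_trans m1oo.
  by apply: le_measure; rewrite ?inE.
- move=> A B mA mB; transitivity (m1 (A `*` B `*` C)); first exact: nE.
  by rewrite m12//; exact/esym/nE.
Qed.

End box_unique3.

Section spin.
Context {R : realType}.
Local Notation U := (uniform_prob (@two_pi_gt0 R)).
Local Notation angles :=
  (measurableTypeR R * measurableTypeR R * measurableTypeR R)%type.

(** The image of a triple of points under a triple of rotations. *)
Definition spin (t : angles) (z : (R * R) * (R * R) * (R * R)) :=
  (rotation t.1.1 z.1.1, rotation t.1.2 z.1.2, rotation t.2 z.2).

(** Three independent uniform angles. *)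
Definition uniform_angles : probability angles R := (U \x U \x U)%E.

Lemma measurable_fun_spin d (T : measurableType d) (f : T -> angles)
    (g : T -> (R * R) * (R * R) * (R * R)) :
  measurable_fun setT f -> measurable_fun setT g ->
  measurable_fun setT (fun x => spin (f x) (g x)).
Proof.
move=> mf mg; apply: measurable_fun_pair; [apply: measurable_fun_pair|];
  apply: measurable_fun_rotation.
- exact: (measurableT_comp measurable_fst (measurableT_comp measurable_fst mf)).
- exact: (measurableT_comp measurable_fst (measurableT_comp measurable_fst mg)).
- exact: (measurableT_comp measurable_snd (measurableT_comp measurable_fst mf)).
- exact: (measurableT_comp measurable_snd (measurableT_comp measurable_fst mg)).
- exact: (measurableT_comp measurable_snd mf).
- exact: (measurableT_comp measurable_snd mg).
Qed.

(** Uniform rotations move three fixed points to independent uniform points of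
    their circles. *)
Lemma uniform_angles_spin z (S : set ((R * R) * (R * R) * (R * R))) :
  measurable S ->
  uniform_angles [set t | S (spin t z)] =
  (uniform_circle (enorm z.1.1) \x uniform_circle (enorm z.1.2) \x
   uniform_circle (enorm z.2))%E S.
Proof.
move=> mS; have mspin : measurable_fun setT (fun t => spin t z).
  by apply: measurable_fun_spin => //; exact: measurable_cst.
have mrot p : measurable_fun setT (fun t : measurableTypeR R => rotation t p).
  by apply: measurable_fun_rotation => //; exact: measurable_cst.
have -> : uniform_angles [set t | S (spin t z)] =
  pushforward uniform_angles (fun t => spin t z) S by [].
apply: measure_box_unique => //.
  suff : (uniform_angles setT < +oo)%E by exact.
  by rewrite probability_setT ltry.
move=> A B C mA mB mC.
have mr p (D : set (R * R)) : measurable D ->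
    measurable [set t : measurableTypeR R | D (rotation t p)].
  by move=> mD; rewrite -[X in measurable X]setTI; exact: (mrot p measurableT _ mD).
have box e1 e2 e3 (E1 : measurableType e1) (E2 : measurableType e2)
    (E3 : measurableType e3) (m1 : probability E1 R) (m2 : probability E2 R)
    (m3 : probability E3 R) D1 D2 D3 :
    measurable D1 -> measurable D2 -> measurable D3 ->
    (m1 \x m2 \x m3)%E (D1 `*` D2 `*` D3) = (m1 D1 * m2 D2 * m3 D3)%E.
  move=> mD1 mD2 mD3; rewrite product_measure1E//; last exact: measurableX.
  by rewrite /= product_measure1E.
rewrite [RHS]box// -!uniform_circle_spin//.
exact: (box _ _ _ _ _ _ U U U _ _ _ (mr _ _ mA) (mr _ _ mB) (mr _ _ mC)).
Qed.

End spin.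

Section average.
Context d (T : measurableType d) (R : realType) (P : probability T R).
Variable X : 'I_3 -> {RV P >-> (R * R)%type}.

Lemma independent3 (A B C : set (R * R)) : independent_RVs X ->
  measurable A -> measurable B -> measurable C ->
  P [set w | (A (X 0 w) /\ B (X 1 w)) /\ C (X 2 w)] =
  (P (X 0%R @^-1` A) * P (X 1%R @^-1` B) * P (X 2%R @^-1` C))%E.
Proof.
move=> indep mA mB mC.
pose F (i : 'I_3) := nth setT [:: A; B; C] i.
have mF i : measurable (F i).
  by case: i => -[|[|[|]]].
have := indep [set: 'I_3]%SET F mF.
rewrite (eq_bigl xpredT); last by move=> i; rewrite inE.
rewrite !big_ord_recr big_ord0 /= mul1e.
have -> : widen_ord (leqnSn 2) (widen_ord (leqnSn 1) ord_max) = 0 :> 'I_3.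
  exact: val_inj.
have -> : widen_ord (leqnSn 2) ord_max = 1 :> 'I_3 by exact: val_inj.
have -> : ord_max = 2 :> 'I_3 by exact: val_inj.
move=> <-; congr (P _); apply/seteqP; split=> w /=.
  move=> [[a b] c] -[[|[|[|//]]] i3] _; rewrite /F /=.
  - by rewrite (_ : Ordinal i3 = 0)//; exact: val_inj.
  - by rewrite (_ : Ordinal i3 = 1)//; exact: val_inj.
  - by rewrite (_ : Ordinal i3 = 2)//; exact: val_inj.
by move=> h; split; [split|]; [apply: (h 0)|apply: (h 1)|apply: (h 2)];
  rewrite /= inE.
Qed.

(** The three vertices as one random variable. *)
Definition vertices w := (X 0 w, X 1 w, X 2 w).

Lemma measurable_vertices : measurable_fun setT vertices.
Proof. by apply: measurable_fun_pair => //; apply: measurable_fun_pair. Qed.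

Lemma measurable_spin_obtuse : measurable [set z |
  obtuse (spin z.2 (vertices z.1)).1.1 (spin z.2 (vertices z.1)).1.2
    (spin z.2 (vertices z.1)).2].
Proof.
have ms : measurable_fun setT (fun z => spin z.2 (vertices z.1)).
  apply: measurable_fun_spin; first exact: measurable_snd.
  exact: (measurableT_comp measurable_vertices measurable_fst).
have := ms measurableT _ (@measurable_obtuse_set R); rewrite setTI; exact.
Qed.

Lemma measurable_prob_obtuse : measurable_fun setT (fun w =>
  prob_obtuse (enorm (X 0 w)) (enorm (X 1 w)) (enorm (X 2 w))).
Proof.
have := measurable_section (@uniform_angles R) measurable_spin_obtuse.
apply: eq_measurable_fun => w _.
exact: (uniform_angles_spin (vertices w) (@measurable_obtuse_set R)).
Qed.

Hypothesis indep : independent_RVs X.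
Hypothesis rot : forall k, rotation_invariant (X k).

(** Rotating the three vertices independently does not change their joint
    law. *)
Lemma vertices_spin t (S : set ((R * R) * (R * R) * (R * R))) : measurable S ->
  P [set w | S (spin t (vertices w))] = P [set w | S (vertices w)].
Proof.
move=> mS.
have mst : measurable_fun setT (fun w => spin t (vertices w)).
  by apply: measurable_fun_spin; [exact: measurable_cst|exact: measurable_vertices].
have mv := measurable_vertices.
have -> : P [set w | S (spin t (vertices w))] =
  pushforward P (fun w => spin t (vertices w)) S by [].
have -> : P [set w | S (vertices w)] = pushforward P vertices S by [].
apply: measure_box_unique => //.
  suff : (P setT < +oo)%E by exact.
  by rewrite probability_setT ltry.
move=> A B C mA mB mC; rewrite /pushforward.
have mr s (D : set (R * R)) : measurable D -> measurable (rotation s @^-1` D).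
  by move=> mD; rewrite -[X in measurable X]setTI; exact: (measurable_rotation s measurableT).
transitivity (P [set w | (A (X 0 w) /\ B (X 1 w)) /\ C (X 2 w)]); last by [].
rewrite independent3//.
have e k s D : measurable D ->
    P (X k @^-1` D) = P (X k @^-1` (rotation s @^-1` D)).
  by move=> mD; exact/esym/(rot k s mD).
rewrite (e 0 t.1.1)// (e 1 t.1.2)// (e 2 t.2)//.
by apply: independent3 => //; exact: mr.
Qed.

(** Fubini on the product of the probability space with the uniform angles. *)
Lemma obtuse_average : P (obtuse_event X) =
  (\int[P]_w prob_obtuse (enorm (X 0%R w)) (enorm (X 1%R w)) (enorm (X 2%R w)))%E.
Proof.
pose O := [set z : (R * R) * (R * R) * (R * R) | obtuse z.1.1 z.1.2 z.2].
have mO : measurable O by exact: measurable_obtuse_set.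
pose A := [set z | O (spin z.2 (vertices z.1))].
have mA : measurable A by exact: measurable_spin_obtuse.
transitivity (\int[P]_w uniform_angles [set t | A (w, t)])%E.
  rewrite (integral_section_swap P (@uniform_angles R) mA).
  transitivity (\int[@uniform_angles R]_t (cst (P (obtuse_event X)) t))%E.
    rewrite integral_cst// [X in (_ * X)%E](_ : _ = 1%E) ?mule1//.
    exact: (probability_setT (@uniform_angles R)).
  by apply: eq_integral => t _ /=; rewrite vertices_spin.
by apply: eq_integral => w _; exact: (uniform_angles_spin (vertices w) mO).
Qed.

End average.
(** * The range of the obtuse probabilities *)

Section expectation_bounds.
Context d (T : measurableType d) (R : realType) (P : probability T R).

(** Almost sure bounds on [f], strict on the right, pass to its integral. *)
Lemma integral_half_one (f : T -> \bar R) (N : set T) :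
  measurable_fun setT f -> (forall w, 0 <= f w <= 1)%E ->
  measurable N -> P N = 0%E ->
  (forall w, ~ N w -> 1 <= 2%:E * f w /\ f w < 1)%E ->
  (1 <= 2%:E * \int[P]_w f w /\ \int[P]_w f w < 1)%E.
Proof.
move=> mf f01 mN PN fN.
have f0 w : (0 <= f w)%E by have /andP[] := f01 w.
have f1 w : (f w <= 1)%E by have /andP[] := f01 w.
have PNC : P (~` N) = 1%E.
  by rewrite probability_setC// [X in (_ - X)%E]PN sube0.
have ffin w : f w \is a fin_num.
  by rewrite ge0_fin_numE//; apply: le_lt_trans (f1 w) _; rewrite ltry.
split.
  rewrite -ge0_integralZl// -[leLHS]PNC -[X in P X]setIT.
  rewrite -integral_indic//; last exact: measurableC.
  apply: ge0_le_integral => //.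
  - by apply/measurable_EFinP; apply: measurable_indic; exact: measurableC.
  - by apply: measurable_funeM.
  move=> w _; rewrite indicE; case: (boolP (w \in _)) => [|_].
    by rewrite inE => /fN[].
  by rewrite mule_ge0.
have mg : measurable_fun setT (fun w => 1 - f w)%E by exact: emeasurable_funB.
have g0 w : (0 <= 1 - f w)%E by rewrite sube_ge0 ?f1// ffin ?orbT.
have sum1 : (\int[P]_w (1 - f w) + \int[P]_w f w = 1)%E.
  rewrite -ge0_integralD//.
  under eq_integral do rewrite subeK//.
  by rewrite integral_cst// [X in (_ * X)%E]probability_setT mule1.
rewrite lt_neqAle; apply/andP; split; last first.
  by rewrite -[leRHS]sum1 leeDr// integral_ge0.
apply/eqP => int1; rewrite int1 in sum1.
have int0 : (\int[P]_w `|1 - f w| = 0)%E.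
  have -> : (\int[P]_w `|1 - f w| = \int[P]_w (1 - f w))%E.
    by apply: eq_integral => w _; rewrite gee0_abs.
  case: (integral P setT _) sum1 => [r| |] // [] r1.
  by have -> : r = 0 by lra.
have [+ _] := ae_eq_integral_abs P measurableT mg.
move=> /(_ int0)[M [mM M0 gM]].
have : (P setT <= P (M `|` N))%E.
  apply: le_measure; rewrite ?inE//; first exact: measurableU.
  move=> w _; have [Nw|nNw] := pselect (N w); [by right|left].
  apply: gM => /= /(_ I) g_eq0; have [_] := fN _ nNw.
  by rewrite -sube_gt0 g_eq0 ltxx.
rewrite probability_setT => h.
have := le_trans h (measureU2 _ mM mN).
by rewrite [X in (X + _)%E]M0 [X in (_ + X)%E]PN adde0 lee_fin ler10.
Qed.

End expectation_bounds.

Section prob_obtuse_fin.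
Context {R : realType}.
Implicit Types r : R.

Lemma prob_obtuse_ge0_le1 r1 r2 r3 : (0 <= prob_obtuse r1 r2 r3 <= 1)%E.
Proof.
rewrite measure_ge0/=; apply: probability_le1; exact: measurable_obtuse_set.
Qed.

Lemma prob_obtuse_fin_num r1 r2 r3 : prob_obtuse r1 r2 r3 \is a fin_num.
Proof.
have /andP[h0 h1] := prob_obtuse_ge0_le1 r1 r2 r3.
by rewrite ge0_fin_numE// (le_lt_trans h1)// ltry.
Qed.

Lemma P_obtE r1 r2 r3 : (P_obt r1 r2 r3)%:E = prob_obtuse r1 r2 r3.
Proof. exact: fineK (prob_obtuse_fin_num r1 r2 r3). Qed.

Lemma measurable_enorm_eq r : measurable [set q : R * R | enorm q = r].
Proof.
apply: measurable_eq_set; last exact: measurable_cst.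
by apply: (@measurable_enorm _ _ _ id); exact: measurable_id.
Qed.

End prob_obtuse_fin.

Section all_triangles.
Context d (T : measurableType d) (R : realType) (P : probability T R).
Variable X : 'I_3 -> {RV P >-> (R * R)%type}.

Lemma pairs_meet (i j a b : 'I_3) : i != j -> a != b ->
  [|| a == i, a == j, b == i | b == j].
Proof.
by case: i => -[|[|[|//]]] ?; case: j => -[|[|[|//]]] ?;
   case: a => -[|[|[|//]]] ?; case: b => -[|[|[|//]]] ?.
Qed.

Lemma random_triangle_bounds : random_triangle X ->
  (1 <= 2%:E * P (obtuse_event X) /\ P (obtuse_event X) < 1)%E.
Proof.
move=> [indep rot [i [j [ij Pi Pj]]]]; rewrite obtuse_average//.
have mn k : measurable [set w | enorm (X k w) = 0].
  apply: measurable_eq_set; last exact: measurable_cst.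
  exact: measurable_enorm.
apply: (@integral_half_one _ _ _ _ _
  ([set w | enorm (X i w) = 0] `|` [set w | enorm (X j w) = 0])).
- exact: measurable_prob_obtuse.
- by move=> w; exact: prob_obtuse_ge0_le1.
- exact: measurableU.
- apply/eqP; rewrite eq_le measure_ge0 andbT.
  apply: (le_trans (measureU2 _ (mn i) (mn j))).
  by rewrite [X in (X + _)%E]Pi [X in (_ + X)%E]Pj adde0.
move=> w /not_orP[/eqP iw /eqP jw].
have ge0 k := enorm_ge0 (X k w).
have pos a b : a != b -> 0 < enorm (X a w) + enorm (X b w).
  move=> ab.
  have := pairs_meet ij ab.
  have pi : 0 < enorm (X i w) by rewrite lt_neqAle eq_sym iw enorm_ge0.
  have pj : 0 < enorm (X j w) by rewrite lt_neqAle eq_sym jw enorm_ge0.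
  have ga := ge0 a; have gb := ge0 b.
  by move=> /or4P[]/eqP e; rewrite {}e in ga gb *; lra.
by apply: prob_obtuse_bounds => //; exact: pos.
Qed.

End all_triangles.

Section triangles_of_radii.
Context {R : realType}.
Variables r0 r1 r2 : R.
Local Notation plane := (R * R)%type.

Let law : probability (plane * plane * plane)%type R :=
  (uniform_circle r0 \x uniform_circle r1 \x uniform_circle r2)%E.
Let radius (k : 'I_3) := nth 0 [:: r0; r1; r2] k.

(** The [k]-th vertex, on the space of triples of points. *)
Definition coordinate (k : 'I_3) (z : plane * plane * plane) : plane :=
  nth z.1.1 [:: z.1.1; z.1.2; z.2] k.

Lemma measurable_coordinate k : measurable_fun setT (coordinate k).
Proof.
case: k => -[|[|[|//]]] ?; rewrite /coordinate /=.
- exact: (measurableT_comp measurable_fst measurable_fst).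
- exact: (measurableT_comp measurable_snd measurable_fst).
- exact: measurable_snd.
Qed.

HB.instance Definition _ k :=
  isMeasurableFun.Build _ _ _ _ (coordinate k) (measurable_coordinate k).

Let X (k : 'I_3) : {RV law >-> plane} := coordinate k.

Let law_box A B C : measurable A -> measurable B -> measurable C ->
  law (A `*` B `*` C) =
  (uniform_circle r0 A * uniform_circle r1 B * uniform_circle r2 C)%E.
Proof.
move=> mA mB mC; rewrite /law [LHS]product_measure1E//; last exact: measurableX.
by rewrite /= product_measure1E.
Qed.

Let law_coordinate k A : measurable A ->
  law (X k @^-1` A) = uniform_circle (radius k) A.
Proof.
move=> mA; have cT r : uniform_circle r setT = 1%E :> \bar R.
  exact: probability_setT.
case: k => -[|[|[|//]]] i3; rewrite /radius /=.
- transitivity (law (A `*` setT `*` setT)); last by rewrite law_box// !cT !mule1.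
  by congr (law _); apply/seteqP; split=> z //= [[]].
- transitivity (law (setT `*` A `*` setT)).
    by congr (law _); apply/seteqP; split=> z //= [[]].
  by rewrite law_box// !cT mul1e mule1.
- transitivity (law (setT `*` setT `*` A)).
    by congr (law _); apply/seteqP; split=> z //= [[]].
  by rewrite law_box// !cT !mul1e.
Qed.

Let X_independent : independent_RVs X.
Proof.
move=> J A mA; pose B i := if i \in J then A i else setT.
have mB i : measurable (B i) by rewrite /B; case: ifP.
transitivity (law (B 0 `*` B 1 `*` B 2)).
  congr (law _); apply/seteqP; split=> z /=.
    move=> h; split; [split|]; rewrite /B; case: ifPn => // iJ; exact: (h _ iJ).
  move=> [[b0 b1] b2] -[[|[|[|//]]] i3] /= iJ.
  - by move: b0; rewrite /B (_ : 0 = Ordinal i3) ?iJ//; exact: val_inj.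
  - by move: b1; rewrite /B (_ : 1 = Ordinal i3) ?iJ//; exact: val_inj.
  - by move: b2; rewrite /B (_ : 2 = Ordinal i3) ?iJ//; exact: val_inj.
rewrite law_box// big_mkcond/= !big_ord_recr big_ord0 /= mul1e.
have -> : widen_ord (leqnSn 2) (widen_ord (leqnSn 1) ord_max) = 0 :> 'I_3.
  exact: val_inj.
have -> : widen_ord (leqnSn 2) ord_max = 1 :> 'I_3 by exact: val_inj.
have -> : ord_max = 2 :> 'I_3 by exact: val_inj.
have e k : (if k \in J then law (X k @^-1` A k) else 1%E) =
    uniform_circle (radius k) (B k).
  rewrite /B; case: ifP => _; first exact: law_coordinate.
  by rewrite probability_setT.
have e0 : _ = uniform_circle r0 (B 0) := e 0.
have e1 : _ = uniform_circle r1 (B 1) := e 1.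
have e2 : _ = uniform_circle r2 (B 2) := e 2.
congr (_ * _ * _)%E; [exact/esym/e0|exact/esym/e1|exact/esym/e2].
Qed.

(** The coordinates under the product law form a random triangle whose vertices
    have constant distances to the origin. *)
Lemma prob_obtuse_achieved : 0 < r1 -> 0 < r2 ->
  achieved_obtuse_probabilities (fine (prob_obtuse r0 r1 r2)).
Proof.
move=> r10 r20; exists _, _, law, X; split; last first.
  by rewrite fineK// prob_obtuse_fin_num.
split; first exact: X_independent.
  move=> k t A mA.
  have mr : measurable (rotation t @^-1` A).
    by rewrite -[X in measurable X]setTI; exact: (measurable_rotation t measurableT).
  transitivity (uniform_circle (radius k) (rotation t @^-1` A)).
    exact: law_coordinate.
  by rewrite [LHS]uniform_circle_rotation//; exact/esym/law_coordinate.
have null k : 0 < radius k -> law [set w | enorm (X k w) = 0] = 0%E.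
  move=> k0; have m0 := @measurable_enorm_eq R 0.
  transitivity (uniform_circle (radius k) [set q | enorm q = 0]).
    exact: (law_coordinate k m0).
  rewrite (@uniform_circle_eq _ _ _ set0) ?measure0//; first exact: ltW.
  by move=> q qk; split=> //= q0; move: k0; rewrite -qk q0 ltxx.
by exists 1, 2; split=> //; exact: null.
Qed.

End triangles_of_radii.

Section right_angle_at_center.
Context {R : realType}.
Local Notation U := (uniform_prob (@two_pi_gt0 R)).
Implicit Types (p q r : R * R) (c m x : R).

Lemma integral_circle_cst m (f : R * R -> \bar R) (k : R) : 0 <= m -> 0 <= k ->
  measurable_fun setT f -> (forall q, 0 <= f q)%E ->
  (forall q, enorm q = m -> f q = k%:E) ->
  (\int[uniform_circle m]_q f q = k%:E)%E.
Proof.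
move=> m0 k0 mf f0 fk.
have e : (\int[uniform_circle m]_q (cst k%:E) q = k%:E)%E.
  rewrite integral_cst// [X in (_ * X)%E](_ : _ = 1%E) ?mule1//.
  exact: probability_setT.
apply/eqP; rewrite eq_le -e; apply/andP; split;
  by apply: le_integral_circle => //= q qm; rewrite fk.
Qed.

(** Nested sets differing by a null set have the same measure. *)
Lemma measure_eq_null d (T : measurableType d) (P : probability T R)
  (A B N : set T) : measurable A -> measurable B -> measurable N ->
  P N = 0%E -> A `<=` B -> B `<=` A `|` N -> P A = P B.
Proof.
move=> mA mB mN N0 AB BAN; apply/eqP; rewrite eq_le; apply/andP; split.
  by apply: le_measure; rewrite ?inE.
have -> : P A = (P A + P N)%E by rewrite [X in (_ + X)%E]N0 adde0.
refine (le_trans _ (measureU2 _ mA mN)).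
by apply: le_measure; rewrite ?inE//; exact: measurableU.
Qed.

Lemma uniform_cos_lt0_or_gt c : 0 < c -> c <= 1 ->
  U [set t | cos t < 0 \/ c < cos t] = (1 / 2 + acos c / pi)%:E.
Proof.
move=> c0 c1; have pi0 := @pi_gt0 R.
have c11 : -1 <= c <= 1 by lra.
have a0 := acos_ge0 c11.
have api := acos_lepi c11.
have mcos : measurable_fun setT (fun t : measurableTypeR R => cos t) :=
  measurable_cos.
have mlt x : measurable ([set t | cos t < x] : set (measurableTypeR R)).
  by apply: measurable_lt_set; measurability.
have mgt x : measurable ([set t | x < cos t] : set (measurableTypeR R)).
  by apply: measurable_lt_set; measurability.
have meq x : measurable ([set t | cos t = x] : set (measurableTypeR R)).
  by apply: measurable_eq_set; measurability.
have mbt x y : measurable ([set t | x < cos t < y] : set (measurableTypeR R)).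
  rewrite (_ : mkset _ = [set t | x < cos t] `&` [set t | cos t < y]).
    exact: measurableI.
  by apply/seteqP; split=> t /= => [/andP|[-> ->]].
transitivity (U ([set t | cos t < 0] `|` [set t | c < cos t])); first by [].
rewrite measureU//; last by apply/seteqP; split=> t //= -[]; lra.
have e1 : U [set t | cos t < 0] = (1 / 2)%:E.
  rewrite -(@measure_eq_null _ _ U [set t | cos pi < cos t < cos (pi / 2)] _
    [set t | cos t = -1])//.
  - rewrite [LHS]uniform_cos_between; [|lra..].
    by congr EFin; move: (@pi R) pi0 {api} => Q Q0; field; rewrite gt_eqF.
  - exact: uniform_cos_eq.
  - by move=> t /= /andP[_]; rewrite cos_pihalf.
  - move=> t /= t0; rewrite cospi cos_pihalf t0 andbT.
    have [h|h] := ltP (-1) (cos t); [by left|right].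
    by apply/eqP; rewrite eq_le h cos_geN1.
have e2 : U [set t | c < cos t] = (acos c / pi)%:E.
  rewrite -(@measure_eq_null _ _ U [set t | cos (acos c) < cos t < cos 0] _
    [set t | cos t = 1])//.
  - by rewrite [LHS]uniform_cos_between ?subr0//.
  - exact: uniform_cos_eq.
  - by move=> t /= /andP[+ _]; rewrite acosK// in_itv.
  - move=> t /= ct; rewrite acosK ?in_itv// cos0 ct /=.
    have [h|h] := ltP (cos t) 1; [by left|right].
    by apply/eqP; rewrite eq_le h cos_le1.
rewrite [X in (X + _)%E]e1 [X in (_ + X)%E]e2.
by rewrite EFinD.
Qed.

(** With one vertex at the origin, [enorm q = 1] and [enorm r = c <= 1], the
    angle at the origin is obtuse when [dot r q < 0], the one at [r] when
    [c ^+ 2 < dot r q], and the one at [q] never is. *)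
Lemma prob_obtuse_center c : 0 < c -> c <= 1 ->
  prob_obtuse 0 1 c = (1 / 2 + acos c / pi)%:E.
Proof.
move=> c0 c1; have pi0 := @pi_gt0 R.
have v0 : 0 <= 1 / 2 + acos c / pi.
  have c11 : -1 <= c <= 1 by lra.
  by have := divr_ge0 (acos_ge0 c11) (ltW pi0); lra.
have mO := @measurable_obtuse_set R.
rewrite prob_obtuseE; apply: integral_circle_cst => //.
- exact: (measurable_section12 _ _ mO).
- by move=> p; exact: integral_ge0.
move=> p /enorm_eq0 ->.
have mo : measurable_fun setT
    (fun q => uniform_circle c [set r | obtuse 0 q r]).
  apply: (@measurable_section _ _ _ _ _ (uniform_circle c)
    [set z | obtuse 0 z.1 z.2]).
  by apply: measurable_obtuse;
    [exact: measurable_cst|exact: measurable_fst|exact: measurable_snd].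
apply: integral_circle_cst => // q q1.
pose E := [set y : R | y < 0] `|` [set y : R | c ^+ 2 < y].
have mE : measurable E.
  by apply: measurableU; apply: measurable_lt_set; measurability.
have mEq : measurable [set r | E (dot r q)].
  rewrite -[X in measurable X]setTI.
  have mdq : measurable_fun setT (fun r => dot r q) by measurability.
  exact: (mdq measurableT _ mE).
pose u : R * R := (- q.2, q.1).
have q0 : q != 0.
  by apply/eqP => e; move: q1; rewrite e /enorm /dot/= mulr0 addr0 sqrtr0; lra.
have u0 : u != 0.
  apply/eqP => -[/eqP + v1]; rewrite oppr_eq0 => /eqP v2.
  by move/eqP: q0; apply; apply: injective_projections.
have mob : measurable [set r | obtuse 0 q r].
  by apply: measurable_obtuse; [exact: measurable_cst|exact: measurable_cst|
    exact: measurable_id].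
have rq r : enorm r = c -> dot r q <= 1.
  move=> rc; have := cauchy_schwarz r q; rewrite rc q1 mulr1 ler_norml; lra.
pose K := [set r : R * R | enorm r = c].
have mK : measurable K by exact: measurable_enorm_eq.
transitivity (uniform_circle c ([set r | obtuse 0 q r] `&` K)).
  apply: uniform_circle_eq; first exact: ltW.
  by move=> r rc; split=> [|[]].
transitivity (uniform_circle c ([set r | E (dot r q)] `&` K)).
  have m1 : measurable ([set r | obtuse 0 q r] `&` K) by exact: measurableI.
  have m2 : measurable ([set r | E (dot r q)] `&` K) by exact: measurableI.
  have d1 r : dot (q - 0) (r - 0) = dot r q by rewrite /dot/=; ring.
  have d2 r : dot (r - q) (0 - q) = enorm q ^+ 2 - dot r q.
    by rewrite enorm_sqr /dot/=; ring.
  have d3 r : dot (0 - r) (q - r) = enorm r ^+ 2 - dot r q.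
    by rewrite enorm_sqr /dot/=; ring.
  apply: (@measure_eq_null _ _ (uniform_circle c) _ _ [set r | dot r u = 0]) => //.
  - by apply: measurable_eq_set; measurability.
  - exact: uniform_circle_dot_eq.
  - move=> r [/obtuseP[_]]; rewrite d1 d2 d3 q1 => h rc; split=> //.
    by have := rq r rc; rewrite /E/=; case: h; rewrite ?rc => h k;
      [left|exfalso; lra|right; lra].
  - move=> r [h rc]; have [e|n] := eqVneq (dot r u) 0; [by right|left].
    split=> //; apply/obtuseP; split.
      rewrite /nondegenerate; apply: contra_neq n => n.
      by move: n; rewrite /dot /u/=; lra.
    by rewrite d1 d3 rc; case: h => /= h; [apply: Or31|apply: Or33; lra].
transitivity (uniform_circle c [set r | E (dot r q)]).
  apply: uniform_circle_eq; first exact: ltW.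
  by move=> r rc; split=> [[]|].
rewrite (uniform_circle_dot c q mE) q1 -uniform_cos_lt0_or_gt//.
congr (U _); apply/funext => t; apply/propext; rewrite /E /circle_point/=.
by rewrite mul1r pmulr_rlt0// expr2 ltr_pM2l.
Qed.

End right_angle_at_center.

Theorem proposition6p1 (R : realType) :
  (forall (d : measure_display) (T : measurableType d) (P : probability T R)
      (X : 'I_3 -> {RV P >-> (R * R)%type}),
    random_triangle X ->
    P (obtuse_event X) =
    ('E_P[fun w => (P_obt (enorm (X 0 w)) (enorm (X 1 w)) (enorm (X 2 w)))%R])%E)
  /\ @achieved_obtuse_probabilities R = `[1 / 2, 1[%classic.
Proof.
split=> [d T P X [indep rot _]|].
  rewrite obtuse_average// unlock; apply: eq_integral => w _.
  by rewrite P_obtE.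
apply/seteqP; split=> p /=; rewrite in_itv/=.
  move=> [d [T [P [X [trX Pp]]]]]; have := random_triangle_bounds trX.
  by rewrite Pp -EFinM lee_fin lte_fin => -[h1 h2]; rewrite h2 andbT; lra.
move=> /andP[p1 p2]; have pi0 := @pi_gt0 R.
(* The radius [cos a] makes [acos (cos a) / pi] the excess of [p] over one
   half. *)
pose a := pi * (p - 1 / 2).
have a0 : 0 <= a by apply: mulr_ge0; lra.
have a2 : a < pi / 2 by rewrite /a; nra.
have c0 : 0 < cos a by apply: cos_gt0_pihalf; lra.
suff -> : p = fine (prob_obtuse 0 1 (cos a)) by exact: prob_obtuse_achieved.
rewrite prob_obtuse_center ?cos_le1//= cosK; last by rewrite in_itv/=; lra.
have -> : a / pi = p - 1 / 2 by rewrite /a [pi * _]mulrC mulfK// gt_eqF.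
lra.
Qed.
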